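(* Let $\Omega\subset\mathbb{R}$ be a bounded open interval with a mesh $\mathcal{T}_H$, and suppose that $f$ is piecewise constant on $\mathcal{T}_H$ (i.e. constant on each $K\in\mathcal{T}_H$). Let $u^\varepsilon\in H^1_0(\Omega)$ be the unique solution to $a^\varepsilon(u^\varepsilon,v)=\int_\Omega f\,v$ for all $v\in H^1_0(\Omega)$, and let $u_{H,B}^{\varepsilon,\mathrm{adv}}\in V_{H,B}^{\varepsilon,\mathrm{adv}}$ be the Adv-MsFEM-lin-B approximation, i.e. the unique element of $V_{H,B}^{\varepsilon,\mathrm{adv}}$ such that $$a^\varepsilon\big(u_{H,B}^{\varepsilon,\mathrm{adv}},v\big)=\int_\Omega f\,v\qquad\text{for all } v\in V_{H,B}^{\varepsilon,\mathrm{adv}}.$$ Then Adv-MsFEM-lin-B is exact, that is, $u_{H,B}^{\varepsilon,\mathrm{adv}}=u^\varepsilon$.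
   Context: The diffusion coefficient $A^\varepsilon\in L^\infty(\Omega)$ satisfies $m\le A^\varepsilon(x)\le M$ for almost all $x\in\Omega$, with constants $0<m\le M$. The advection field $b\in L^\infty(\Omega)$ is divergence-free (i.e. $b$ is constant in dimension one). The bilinear form is $$a^\varepsilon(u,v)=\int_\Omega A^\varepsilon u'v'+v\,b\,u',$$ associated with $\mathcal{L}^\varepsilon u=-(A^\varepsilon u')'+b\,u'$; the problem for $u^\varepsilon$ is the weak form of $\mathcal{L}^\varepsilon u^\varepsilon=f$ in $\Omega$ with $u^\varepsilon=0$ on $\partial\Omega$. Mesh: $\mathcal{T}_H$ is a subdivision of $\Omega$ into finitely many intervals $K$, with internal nodes $x_1,\dots,x_N$. Basis functions: for $1\le i\le N$, $\phi_i^{\varepsilon,\mathrm{adv}}\in H^1_0(\Omega)$ is the unique function with $\phi_i^{\varepsilon,\mathrm{adv}}(x_j)=\delta_{i,j}$ for all $1\le j\le N$ and $\mathcal{L}^\varepsilon\phi_i^{\varepsilon,\mathrm{adv}}=0$ weakly in each $K\in\mathcal{T}_H$. Bubbles: for $K\in\mathcal{T}_H$, $B_K^{\varepsilon,\mathrm{adv}}\in H^1_0(K)$ is the unique weak solution to $\mathcal{L}^\varepsilon B_K^{\varepsilon,\mathrm{adv}}=1$ in $K$, $B_K^{\varepsilon,\mathrm{adv}}=0$ on $\partial K$, extended by $0$ outside $K$. The approximation space is $V_{H,B}^{\varepsilon,\mathrm{adv}}=\operatorname{Span}\{\phi_i^{\varepsilon,\mathrm{adv}},\ 1\le i\le N\}\oplus\operatorname{Span}\{B_K^{\varepsilon,\mathrm{adv}},\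 K\in\mathcal{T}_H\}$. *)

(* Defs.v *)
From HB Require Import structures.
From mathcomp Require Import all_boot all_order all_algebra.
From mathcomp Require Import all_classical all_reals all_analysis.
Set Implicit Arguments.
Unset Strict Implicit.
Unset Printing Implicit Defensive.
Import Order.TTheory GRing.Theory Num.Theory.
Import numFieldNormedType.Exports.
Local Open Scope classical_set_scope.
Local Open Scope ring_scope.

(** Functions on an open interval [I] are represented by functions [R -> R] of
    which only the values on [I] matter, up to almost everywhere equality. *)

Section Sobolev.
Context {R : realType}.
Local Notation mu := (@lebesgue_measure R).
Implicit Types (I : set R) (u v g : R -> R).

Definition L2 I u : Prop :=
  measurable_fun I u /\ mu.-integrable I (fun x => (u x ^+ 2)%:E).

Definition Linfty I u : Prop :=
  measurable_fun I u /\
  exists C : R, {ae mu, forall x, I x -> `|u x| <= C}.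

(** Test functions are [C^1] with compact support in [I], as in Brezis,
    "Functional Analysis, Sobolev Spaces and PDE", Chapter 8; they are defined
    on the whole line and vanish outside [I]. *)
Definition Cc1 I (phi : R -> R) : Prop :=
  [/\ forall x, derivable phi x 1,
      continuous (derive1 phi),
      compact (closure [set x | phi x != 0]) &
      closure [set x | phi x != 0] `<=` I].

Definition is_wderiv I u g : Prop :=
  forall phi, Cc1 I phi ->
    \int[mu]_(x in I) (u x * derive1 phi x) = - \int[mu]_(x in I) (g x * phi x).

Definition H1 I u : Prop :=
  L2 I u /\ exists g, L2 I g /\ is_wderiv I u g.

(** The weak derivative on [I] of [u], for [u] in [H1 I] (unique up to almost
    everywhere equality); a default value otherwise. *)
Definition wderiv I u : R -> R :=
  xget (fun=> 0) [set g | L2 I g /\ is_wderiv I u g].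

(** Closure of the test functions for the [H1 I] norm. *)
Definition H10 I u : Prop :=
  H1 I u /\
  exists phi : nat -> R -> R,
    (forall n, Cc1 I (phi n)) /\
    (fun n => \int[mu]_(x in I) (phi n x - u x) ^+ 2
            + \int[mu]_(x in I) (derive1 (phi n) x - wderiv I u x) ^+ 2)
      @ \oo --> (0 : R).

(** [y] is the value at [x] of the continuous representative of [u] on [I]. *)
Definition point_value I u (x y : R) : Prop :=
  exists ur : R -> R,
    [/\ {within I, continuous ur},
        {ae mu, forall z, I z -> u z = ur z} &
        ur x = y].

End Sobolev.

Section AdvMsFEM.
Context {R : realType}.
Local Notation mu := (@lebesgue_measure R).

(** In dimension one the divergence of [b] is its (weak) derivative. *)
Definition divergence_free (I : set R) (b : R -> R) : Prop :=
  is_wderiv I b (fun=> 0).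

Definition aform (A b : R -> R) (I : set R) (u v : R -> R) : R :=
  \int[mu]_(x in I) (A x * wderiv I u x * wderiv I v x
                     + v x * b x * wderiv I u x).

(** [w] solves [- (A w')' + b w' = g] weakly in [I]; no boundary condition. *)
Definition weak_sol (A b : R -> R) (I : set R) (g w : R -> R) : Prop :=
  forall v, H10 I v -> aform A b I w v = \int[mu]_(x in I) (g x * v x).

(** [x 0 = l] and [x N.+1 = r] are the boundary points; [x 1, ..., x N] are the
    internal nodes. *)
Definition is_mesh (l r : R) (N : nat) (x : nat -> R) : Prop :=
  [/\ x 0%N = l, x N.+1 = r & forall k, (k <= N)%N -> x k < x k.+1].

Definition elt (x : nat -> R) (k : nat) : set R := `]x k, x k.+1[%classic.

Definition piecewise_constant (N : nat) (x : nat -> R) (f : R -> R) : Prop :=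
  forall k : 'I_N.+1, exists c : R, forall y, elt x k y -> f y = c.

(** [phi i] is attached to the internal node [x i.+1], since [i : 'I_N] is
    counted from zero. *)
Definition is_basis (A b : R -> R) (Omega : set R) (N : nat) (x : nat -> R)
    (phi : 'I_N -> R -> R) : Prop :=
  forall i : 'I_N,
    [/\ H10 Omega (phi i),
        forall j : 'I_N, point_value Omega (phi i) (x j.+1) (i == j)%:R &
        forall k : 'I_N.+1, weak_sol A b (elt x k) (fun=> 0) (phi i)].

Definition is_bubbles (A b : R -> R) (N : nat) (x : nat -> R)
    (B : 'I_N.+1 -> R -> R) : Prop :=
  forall k : 'I_N.+1,
    [/\ H10 (elt x k) (B k),
        weak_sol A b (elt x k) (fun=> 1) (B k) &
        forall y, ~ elt x k y -> B k y = 0].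

Definition VHB (N : nat) (phi : 'I_N -> R -> R) (B : 'I_N.+1 -> R -> R) :
    set (R -> R) :=
  [set v | exists (c : 'I_N -> R) (d : 'I_N.+1 -> R),
     forall y, v y = \sum_(i < N) c i * phi i y + \sum_(k < N.+1) d k * B k y].

End AdvMsFEM.

(* Main.v *)
Require Import Defs.
From HB Require Import structures.
From mathcomp Require Import all_boot all_order all_algebra.
From mathcomp Require Import all_classical all_reals all_analysis.
From mathcomp Require Import measurable_realfun ring lra.
Set Implicit Arguments.
Unset Strict Implicit.
Unset Printing Implicit Defensive.
Import Order.TTheory GRing.Theory Num.Theory.
Import numFieldNormedType.Exports.
Local Open Scope classical_set_scope.
Local Open Scope ring_scope.

(** The advection field has weak derivative zero, so it
    is a constant [beta] ([wderiv0_const]), and [a(u, v)] is the L^2 product of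
    [u'] with [A v' + beta v] ([aformE]).

    Let [v*] be the function of the discrete space that has the same values as
    [u] at the nodes, and whose coefficient on the bubble of an element is the
    value of [f] there. The residual [z = u - v*] vanishes at all nodes and
    solves the homogeneous equation in each element [K]. Testing this equation
    with [z] itself would first require that the restriction of [z] to [K] be a
    limit of test functions on [K]; instead, by the lemma of du Bois-Reymond, the
    flux [A z' - beta z] is constant on [K]. Multiply it by [z'] and integrate:
    the integrals over [K] of [z'] and of [z z'] are the increments of [z] and
    of [z^2 / 2], which are zero, and [int_K A z'^2 = 0] remains
    ([zero_increment_eq0]). Hence [z' = 0] on all elements, and [u = v*] almost
    everywhere ([dresidual_eq0]).

    The discrete solution and [u] therefore both lie in the discrete space, up
    to equality almost everywhere, and [a(u - u_HB, v) = 0] for all [v] in it.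
    Taking for [v] the difference itself, coercivity concludes
    ([msfem_exact]).

    The one-dimensional Sobolev theory behind this argument rests on two facts.
    The first is the fundamental lemma of the calculus of variations
    ([fundamental_lemma]), which yields uniqueness of weak derivatives and the
    lemma of du Bois-Reymond. The second is that a function of [H^1_0(a, b)] is
    almost everywhere equal to the integral from [a] of its weak derivative
    ([ae_eq_prim]); nodal values, and the identity for [int z z'], come from the
    corresponding ones for the approximating test functions by continuity of the
    inner product ([ip_cvg]). *)

(** * Square-integrable functions *)
Section SquareIntegrable.
Context {R : realType}.
Local Notation mu := (@lebesgue_measure R).
Implicit Types (D E : set R) (f g h u v : R -> R).

Definition ip D f g : R := \int[mu]_(x in D) (f x * g x).

Lemma aeS (P Q : R -> Prop) : (forall x, P x -> Q x) ->
  {ae mu, forall x, P x} -> {ae mu, forall x, Q x}.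
Proof. by apply: filterS; exact: (ae_filter_ringOfSetsType mu). Qed.

Lemma aeS2 (P Q T : R -> Prop) : (forall x, P x -> Q x -> T x) ->
  {ae mu, forall x, P x} -> {ae mu, forall x, Q x} -> {ae mu, forall x, T x}.
Proof. by apply: filterS2; exact: (ae_filter_ringOfSetsType mu). Qed.

Lemma le_integrable_ae D f g : measurable D -> measurable_fun D f ->
  mu.-integrable D (EFin \o g) ->
  {ae mu, forall x, D x -> `|f x| <= `|g x|} -> mu.-integrable D (EFin \o f).
Proof.
move=> mD mf /integrableP[mg ig] fg; apply/integrableP; split.
  exact/measurable_EFinP.
apply: le_lt_trans ig; apply: ae_ge0_le_integral => //.
- by apply: measurableT_comp => //; exact/measurable_EFinP.
- exact: measurableT_comp.
Qed.

Lemma intD D f g : measurable D -> mu.-integrable D (EFin \o f) ->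
  mu.-integrable D (EFin \o g) ->
  mu.-integrable D (EFin \o (fun x => f x + g x)).
Proof.
move=> mD intf intg.
by apply: eq_integrable (@integrableD _ _ _ mu D mD _ _ intf intg).
Qed.

Lemma intZ D a f : measurable D -> mu.-integrable D (EFin \o f) ->
  mu.-integrable D (EFin \o (fun x => a * f x)).
Proof.
move=> mD intf.
by apply: eq_integrable (@integrableZl _ _ _ mu D mD a _ intf).
Qed.

Lemma L2_meas D f : L2 D f -> measurable_fun D f. Proof. by case. Qed.

Lemma L2_ip D f g : measurable D -> L2 D f -> L2 D g ->
  mu.-integrable D (EFin \o (fun x => f x * g x)).
Proof.
move=> mD [mf f2] [mg g2].
have fg2 : mu.-integrable D (EFin \o (fun x => f x ^+ 2 + g x ^+ 2)).
  exact: (intD mD f2 g2).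
apply: (le_integrable_ae mD _ fg2); first exact: measurable_funM.
apply: aeW => x _; rewrite (ger0_norm (addr_ge0 (sqr_ge0 _) (sqr_ge0 _))).
rewrite ler_norml; apply/andP; split; nra.
Qed.

Lemma L2M D f g : measurable D -> Linfty D f -> L2 D g ->
  L2 D (fun x => f x * g x).
Proof.
move=> mD [mf [C fC]] [mg g2].
have mfg : measurable_fun D (fun x => f x * g x) by exact: measurable_funM.
split => //; have := intZ (C ^+ 2) mD g2 => Cg2.
apply: (@le_integrable_ae D _ (fun x => C ^+ 2 * g x ^+ 2)) => //.
  exact: (measurable_funX 2 mfg).
apply: aeS fC => x fC Dx /=; have {}fC := fC Dx.
rewrite -exprMn 2!normrX lerXn2r ?nnegrE// !normrM ler_wpM2r//.
by rewrite (le_trans fC)// ler_norm.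
Qed.

Lemma L2D D f g : measurable D -> L2 D f -> L2 D g -> L2 D (fun x => f x + g x).
Proof.
move=> mD Lf Lg; case: (Lf) (Lg) => mf f2 [mg g2].
have mfg : measurable_fun D (fun x => f x + g x) by exact: measurable_funD.
split => //.
have fg := L2_ip mD Lf Lg.
have := intD mD (intD mD f2 g2) (intD mD fg fg).
apply: eq_integrable => // x _ /=; congr EFin; ring.
Qed.

Lemma L2Z D a f : measurable D -> L2 D f -> L2 D (fun x => a * f x).
Proof.
move=> mD; apply: L2M => //; split; first exact: measurable_cst.
by exists `|a|; exact: aeW.
Qed.

Lemma L2B D f g : measurable D -> L2 D f -> L2 D g -> L2 D (fun x => f x - g x).
Proof.
move=> mD Lf Lg; rewrite (_ : (fun x => _) = (fun x => f x + (-1) * g x)).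
  by apply: L2D => //; exact: L2Z.
by apply/funext => x; rewrite mulN1r.
Qed.

Lemma L2S D E f : measurable D -> measurable E -> E `<=` D -> L2 D f -> L2 E f.
Proof.
move=> mD mE ED [mf f2]; split; first exact: (measurable_funS mD ED mf).
exact: (@integrableS _ _ _ mu D E).
Qed.

Lemma eq_L2 D f g : measurable D -> (forall x, D x -> f x = g x) -> L2 D f -> L2 D g.
Proof.
move=> mD fg [mf f2]; have fgD : {in D, f =1 g} by move=> x /set_mem /fg.
split; first exact: eq_measurable_fun mf.
apply: (@eq_integrable _ _ _ mu D mD _ _ _ f2) => x xD /=.
by rewrite fgD.
Qed.

Lemma ipC D f g : ip D f g = ip D g f.
Proof. by apply: eq_Rintegral => x _; rewrite mulrC. Qed.

Lemma ip0l D f : ip D (fun=> 0) f = 0.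
Proof. by rewrite /ip /Rintegral integral0_eq// => x _; rewrite mul0r. Qed.

Lemma ip0r D f : ip D f (fun=> 0) = 0.
Proof. by rewrite ipC ip0l. Qed.

Lemma ipDl D f g h : measurable D -> L2 D f -> L2 D g -> L2 D h ->
  ip D (fun x => f x + g x) h = ip D f h + ip D g h.
Proof.
move=> mD Lf Lg Lh; rewrite /ip -RintegralD//; try exact: L2_ip.
by apply: eq_Rintegral => x _; rewrite mulrDl.
Qed.

Lemma ipZl D a f h : measurable D -> L2 D f -> L2 D h ->
  ip D (fun x => a * f x) h = a * ip D f h.
Proof.
move=> mD Lf Lh; rewrite /ip -RintegralZl//; try exact: L2_ip.
by apply: eq_Rintegral => x _; rewrite mulrA.
Qed.

Lemma ipBl D f g h : measurable D -> L2 D f -> L2 D g -> L2 D h ->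
  ip D (fun x => f x - g x) h = ip D f h - ip D g h.
Proof.
move=> mD Lf Lg Lh; rewrite /ip -RintegralB//; try exact: L2_ip.
by apply: eq_Rintegral => x _; rewrite mulrBl.
Qed.

Lemma ipDr D f g h : measurable D -> L2 D f -> L2 D g -> L2 D h ->
  ip D h (fun x => f x + g x) = ip D h f + ip D h g.
Proof. by move=> *; rewrite ipC ipDl// !(ipC D h). Qed.

Lemma ipZr D a f h : measurable D -> L2 D f -> L2 D h ->
  ip D h (fun x => a * f x) = a * ip D h f.
Proof. by move=> *; rewrite ipC ipZl// !(ipC D h). Qed.

Lemma ipBr D f g h : measurable D -> L2 D f -> L2 D g -> L2 D h ->
  ip D h (fun x => f x - g x) = ip D h f - ip D h g.
Proof. by move=> *; rewrite ipC ipBl// !(ipC D h). Qed.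

Lemma ip_ge0 D f : 0 <= ip D f f.
Proof. by apply: Rintegral_ge0 => x _; rewrite -expr2 sqr_ge0. Qed.

Lemma ip_ae D f g h : measurable D -> L2 D f -> L2 D g -> L2 D h ->
  {ae mu, forall x, D x -> f x = g x} -> ip D f h = ip D g h.
Proof.
move=> mD Lf Lg Lh fg; congr fine; apply: ae_eq_integral => //.
- by apply/measurable_EFinP/measurable_funM; exact: L2_meas.
- by apply/measurable_EFinP/measurable_funM; exact: L2_meas.
- by apply: aeS fg => x fg /= Dx; rewrite fg.
Qed.

Lemma ip_sub D E f g : (forall x, D x -> ~ E x -> f x = 0 \/ g x = 0) ->
  E `<=` D -> ip D f g = ip E f g.
Proof.
move=> fg0 ED; rewrite /ip Rintegral_mkcond [RHS]Rintegral_mkcond.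
congr Rintegral; apply/funext => x; rewrite !patchE.
case: ifPn => xD; case: ifPn => xE //.
  rewrite notin_setE in xE; case: (fg0 x _ xE) => [|->|->]; rewrite ?mul0r ?mulr0//.
  exact: set_mem.
by rewrite notin_setE in xD; case: xD; apply: ED; exact: set_mem.
Qed.

Lemma ip_le_sub D E f : measurable D -> measurable E -> E `<=` D -> L2 D f ->
  ip E f f <= ip D f f.
Proof.
move=> mD mE ED Lf; have LEf := L2S mD mE ED Lf.
apply: fine_le; try by apply: integrable_fin_num => //; exact: L2_ip.
apply: ge0_subset_integral => //.
  by apply/measurable_EFinP/measurable_funM; exact: L2_meas.
by move=> x _; rewrite lee_fin -expr2 sqr_ge0.
Qed.

Lemma ip_eq0 D f : measurable D -> L2 D f -> ip D f f = 0 ->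
  {ae mu, forall x, D x -> f x = 0}.
Proof.
move=> mD Lf f0.
have mff : measurable_fun D (fun x => (f x * f x)%:E).
  by apply/measurable_EFinP/measurable_funM; exact: L2_meas.
have i0 : (\int[mu]_(x in D) `|(f x * f x)%:E| = 0)%E.
  transitivity (\int[mu]_(x in D) (f x * f x)%:E)%E.
    by apply: eq_integral => x _; rewrite gee0_abs// lee_fin -expr2 sqr_ge0.
  rewrite -[LHS]fineK; first by congr EFin.
  by apply: integrable_fin_num => //; exact: L2_ip.
have := (ae_eq_integral_abs mu mD mff).1 i0.
apply: aeS => x fx Dx; have := fx Dx => -[] /eqP.
by rewrite mulf_eq0 orbb => /eqP.
Qed.

(** The polynomial [t |-> |f - t g|^2] is nonnegative; evaluate it at its
    minimum [t = <f, g> / |g|^2], or at a large [t] when [|g| = 0]. *)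
Lemma cauchy_schwarz D f g : measurable D -> L2 D f -> L2 D g ->
  ip D f g ^+ 2 <= ip D f f * ip D g g.
Proof.
move=> mD Lf Lg.
have H t : 0 <= ip D f f - 2 * t * ip D f g + t ^+ 2 * ip D g g.
  have Lt := L2Z t mD Lg; have Lft := L2B mD Lf Lt.
  apply: le_trans (ip_ge0 D (fun x => f x - t * g x)) _.
  rewrite ipBl// !ipBr// !ipZl// !ipZr// (ipC D g f).
  by rewrite le_eqVlt; apply/orP; left; apply/eqP; ring.
have F0 := ip_ge0 D f; have G0 := ip_ge0 D g.
set F := ip D f f in H F0 *; set G := ip D g g in H G0 *.
set P := ip D f g in H *.
have [G00|Gn0] := eqVneq G 0; last first.
  have := H (P / G); rewrite (_ : _ + _ = F - P ^+ 2 / G); last by field.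
  by rewrite subr_ge0 ler_pdivrMr// lt_neqAle eq_sym Gn0.
rewrite G00 mulr0; have [->|P0] := eqVneq P 0; first by rewrite expr0n.
have := H ((F + 1) / (2 * P)); rewrite G00.
by rewrite (_ : _ + _ = -1) ?oppr_ge0 ?ler10//; field.
Qed.

Lemma L2_0 D : measurable D -> L2 D (fun=> 0).
Proof.
move=> mD; split; first exact: measurable_cst.
apply: (@eq_integrable _ _ _ mu D mD (cst 0%E)); last exact: integrable0.
by move=> x _; rewrite expr0n.
Qed.

Lemma L2_sum D (n : nat) (s : 'I_n -> R) (g : 'I_n -> R -> R) : measurable D ->
  (forall i, L2 D (g i)) -> L2 D (fun x => \sum_(i < n) s i * g i x).
Proof.
move=> mD Lg; elim: (index_enum _) => [|i r IH].
  by apply: eq_L2 (L2_0 mD) => // x _; rewrite big_nil.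
apply: (@eq_L2 _ (fun x => s i * g i x + \sum_(i <- r) s i * g i x)) => //.
  by move=> x _; rewrite big_cons.
by apply: L2D => //; exact: L2Z.
Qed.

Lemma ip_suml D (n : nat) (s : 'I_n -> R) (g : 'I_n -> R -> R) h : measurable D ->
  (forall i, L2 D (g i)) -> L2 D h ->
  ip D (fun x => \sum_(i < n) s i * g i x) h = \sum_(i < n) s i * ip D (g i) h.
Proof.
move=> mD Lg Lh.
suff [] : L2 D (fun x => \sum_(i < n) s i * g i x) /\
  ip D (fun x => \sum_(i < n) s i * g i x) h = \sum_(i < n) s i * ip D (g i) h by [].
elim: (index_enum _) => [|i r [IL IH]].
  rewrite big_nil (_ : (fun x => _) = fun=> 0); last by apply/funext => x; rewrite big_nil.
  by rewrite ip0l; split; [exact: L2_0|].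
rewrite big_cons (_ : (fun x => _) = fun x => s i * g i x + \sum_(i <- r) s i * g i x); last first.
  by apply/funext => x; rewrite big_cons.
have Lsg := L2Z (s i) mD (Lg i); split; first exact: L2D.
by rewrite ipDl// ipZl// IH.
Qed.

End SquareIntegrable.

(** * Convergence in the mean square *)
Section L2Convergence.
Context {R : realType}.
Local Notation mu := (@lebesgue_measure R).
Implicit Types (D E : set R) (f g h u v : R -> R).

Definition L2cvg D (f_ : nat -> R -> R) f : Prop :=
  (fun n => ip D (fun x => f_ n x - f x) (fun x => f_ n x - f x)) @ \oo --> (0 : R).

Lemma cvgn_cst (c : R) : (fun _ : nat => c) @ \oo --> c.
Proof. exact: cvg_cst. Qed.
Arguments cvgn_cst : clear implicits.

Lemma eq_cvgn (u v : nat -> R) (c : R) : u =1 v -> u @ \oo --> c -> v @ \oo --> c.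
Proof. by move=> /funext ->. Qed.

Lemma cvgnD (u v : nat -> R) (a c : R) : u @ \oo --> a -> v @ \oo --> c ->
  (fun n => u n + v n) @ \oo --> (a + c : R).
Proof. exact: cvgD. Qed.

Lemma cvgnM (u v : nat -> R) (a c : R) : u @ \oo --> a -> v @ \oo --> c ->
  (fun n => u n * v n) @ \oo --> (a * c : R).
Proof. exact: cvgM. Qed.

Lemma squeeze0 (u v : nat -> R) : (forall n, 0 <= u n <= v n) ->
  v @ \oo --> (0 : R) -> u @ \oo --> (0 : R).
Proof.
move=> uv v0; apply: (@squeeze_cvgr _ _ _ _ (fun=> 0) v) => //.
  exact: nearW.
exact: cvgn_cst.
Qed.

Lemma cauchy_schwarz_sqrt D f g : measurable D -> L2 D f -> L2 D g ->
  `|ip D f g| <= Num.sqrt (ip D f f) * Num.sqrt (ip D g g).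
Proof.
move=> mD Lf Lg; rewrite -sqrtrM ?ip_ge0// -sqrtr_sqr ler_wsqrtr//.
exact: cauchy_schwarz.
Qed.

(** Cauchy-Schwarz: a sequence tending to zero in norm, paired with one whose
    norms converge, gives products tending to zero. *)
Lemma ip_cvg0 D (f_ g_ : nat -> R -> R) (c : R) : measurable D ->
  (forall n, L2 D (f_ n)) -> (forall n, L2 D (g_ n)) ->
  (fun n => ip D (f_ n) (f_ n)) @ \oo --> (0 : R) ->
  (fun n => ip D (g_ n) (g_ n)) @ \oo --> (c : R) ->
  (fun n => ip D (f_ n) (g_ n)) @ \oo --> (0 : R).
Proof.
move=> mD Lf Lg f0 gc; apply/norm_cvg0P.
have sqc (w : nat -> R) l : w @ \oo --> l -> (Num.sqrt \o w) @ \oo --> Num.sqrt l.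
  by move=> wl; apply: continuous_cvg => //; exact: sqrt_continuous.
have h : (fun n => Num.sqrt (ip D (f_ n) (f_ n)) * Num.sqrt (ip D (g_ n) (g_ n)))
    @ \oo --> (0 : R).
  by rewrite -(mul0r (Num.sqrt c)) -(sqrtr0 R); apply: cvgM; exact: sqc.
by apply: (squeeze0 _ h) => n; rewrite normr_ge0/= cauchy_schwarz_sqrt.
Qed.

(** Every limit passage below is an instance of this continuity of the inner
    product, expanded around the two limits:
    [<f_n, g_n> = <f_n - f, g_n - g> + <f_n - f, g> + <f, g_n - g> + <f, g>]. *)
Lemma ip_cvg D (f_ g_ : nat -> R -> R) f g : measurable D ->
  (forall n, L2 D (f_ n)) -> L2 D f -> (forall n, L2 D (g_ n)) -> L2 D g ->
  L2cvg D f_ f -> L2cvg D g_ g ->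
  (fun n => ip D (f_ n) (g_ n)) @ \oo --> (ip D f g : R).
Proof.
move=> mD Lf_ Lf Lg_ Lg ff gg.
have Lff n : L2 D (fun x => f_ n x - f x) by exact: L2B.
have Lgg n : L2 D (fun x => g_ n x - g x) by exact: L2B.
have h1 := ip_cvg0 mD Lff Lgg ff gg.
have h2 := ip_cvg0 mD Lff (fun=> Lg) ff (cvgn_cst _).
have h3 := ip_cvg0 mD Lgg (fun=> Lf) gg (cvgn_cst _).
have := cvgnD (cvgnD (cvgnD h1 h2) h3) (cvgn_cst (ip D f g)).
rewrite !add0r => h; apply: eq_cvgn h => n /=.
rewrite !ipBl// !ipBr// (ipC D (g_ n) f) (ipC D g f).
ring.
Qed.

Lemma L2cvg_cst D f : L2cvg D (fun=> f) f.
Proof.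
rewrite /L2cvg (_ : (fun n => _) = (fun=> 0)); first exact: cvg_cst.
apply/funext => n; rewrite (_ : (fun x => _) = (fun=> 0)).
  by rewrite ip0l.
by apply/funext => x; rewrite subrr.
Qed.

Lemma ip_comb D a u v : measurable D -> L2 D u -> L2 D v ->
  ip D (fun x => a * u x + v x) (fun x => a * u x + v x) =
  a ^+ 2 * ip D u u + 2 * a * ip D u v + ip D v v.
Proof.
move=> mD Lu Lv; have Lau := L2Z a mD Lu; have Ls := L2D mD Lau Lv.
by rewrite ipDl// !ipDr// !ipZl// !ipZr// (ipC D v u); ring.
Qed.

Lemma L2cvgD D a (f_ g_ : nat -> R -> R) f g : measurable D ->
  (forall n, L2 D (f_ n)) -> L2 D f -> (forall n, L2 D (g_ n)) -> L2 D g ->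
  L2cvg D f_ f -> L2cvg D g_ g ->
  L2cvg D (fun n x => a * f_ n x + g_ n x) (fun x => a * f x + g x).
Proof.
move=> mD Lf_ Lf Lg_ Lg ff gg.
have Lff n : L2 D (fun x => f_ n x - f x) by exact: L2B.
have Lgg n : L2 D (fun x => g_ n x - g x) by exact: L2B.
have h1 := ip_cvg0 mD Lff Lgg ff gg.
have := cvgnD (cvgnD (cvgnM (cvgn_cst (a ^+ 2)) ff) (cvgnM (cvgn_cst (2 * a)) h1)) gg.
rewrite !mulr0 !addr0 => h; apply: (eq_cvgn _ h) => n.
rewrite (_ : (fun x => a * f_ n x + g_ n x - (a * f x + g x)) =
    (fun x => a * (f_ n x - f x) + (g_ n x - g x))); last first.
  by apply/funext => x; ring.
by rewrite ip_comb.
Qed.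

Lemma L2cvgS D E (f_ : nat -> R -> R) f : measurable D -> measurable E -> E `<=` D ->
  (forall n, L2 D (f_ n)) -> L2 D f -> L2cvg D f_ f -> L2cvg E f_ f.
Proof.
move=> mD mE ED Lf_ Lf h; apply: (squeeze0 _ h) => n; rewrite ip_ge0/= ip_le_sub//; exact: L2B.
Qed.

Lemma L2cvg_unique D (f_ : nat -> R -> R) f g : measurable D ->
  (forall n, L2 D (f_ n)) -> L2 D f -> L2 D g ->
  L2cvg D f_ f -> L2cvg D f_ g -> {ae mu, forall x, D x -> f x = g x}.
Proof.
move=> mD Lf_ Lf Lg ff fg; have Lh := L2B mD Lf Lg.
have h1 := ip_cvg mD Lf_ Lf (fun=> Lh) Lh ff (L2cvg_cst _ _).
have h2 := ip_cvg mD Lf_ Lg (fun=> Lh) Lh fg (L2cvg_cst _ _).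
have /ip_eq0 : ip D (fun x => f x - g x) (fun x => f x - g x) = 0.
  rewrite ipBl//; apply/eqP; rewrite subr_eq0; apply/eqP.
  exact: (cvg_unique _ h1 h2).
move=> /(_ mD Lh); apply: aeS => x fgx Dx.
by apply/eqP; rewrite -subr_eq0 fgx.
Qed.

End L2Convergence.
Arguments cvgn_cst {R} c.

(** * Calculus of continuously differentiable functions *)
Section ContinuouslyDifferentiable.
Context {R : realType}.
Local Notation mu := (@lebesgue_measure R).
Implicit Types (D E : set R) (f g h u v df dg : R -> R) (a b c d x y : R).

(** The derivative is kept as an explicit argument, so that it can be computed
    compositionally; [derive1] is recovered by [C1_derive1]. *)
Definition C1 f df : Prop := (forall x, is_derive x 1 f (df x)) /\ continuous df.

Lemma C1_derive1 f df : C1 f df -> derive1 f = df.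
Proof.
by move=> [fdf _]; apply/funext => x; rewrite derive1E; apply: (@derive_val _ _ _ _ _ _ _ (fdf x)).
Qed.

Lemma C1_continuous f df : C1 f df -> continuous f.
Proof.
move=> [fdf _] x; apply/differentiable_continuous/derivable1_diffP.
exact: (@ex_derive _ _ _ _ _ _ _ (fdf x)).
Qed.

Lemma C1_cst c : C1 (fun=> c) (fun=> 0).
Proof. by split=> x; [exact: is_derive_cst|exact: cvg_cst]. Qed.

Lemma C1_id : C1 id (fun=> 1).
Proof. by split=> x; [exact: is_derive_id|exact: cvg_cst]. Qed.

Lemma C1D f df g dg : C1 f df -> C1 g dg ->
  C1 (fun x => f x + g x) (fun x => df x + dg x).
Proof.
move=> [fdf cdf] [gdg cdg]; split=> x; last exact: cvgD (cdf x) (cdg x).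
exact: is_deriveD (fdf x) (gdg x).
Qed.

Lemma C1M f df g dg : C1 f df -> C1 g dg ->
  C1 (fun x => f x * g x) (fun x => df x * g x + f x * dg x).
Proof.
move=> Cf Cg; have cf := C1_continuous Cf; have cg := C1_continuous Cg.
move: Cf Cg => [fdf cdf] [gdg cdg]; split=> x; last first.
  exact: cvgD (cvgM (cdf x) (cg x)) (cvgM (cf x) (cdg x)).
apply: (@is_derive_eq _ _ _ _ _ _ _ _ (is_deriveM (fdf x) (gdg x))).
by rewrite addrC /GRing.scale/= (mulrC (g x)).
Qed.

Lemma C1Z c f df : C1 f df -> C1 (fun x => c * f x) (fun x => c * df x).
Proof.
move=> /(C1M (C1_cst c)).
by rewrite (_ : (fun x => 0 * _ + _) = fun x => c * df x)//; apply/funext => x; ring.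
Qed.

Lemma C1B f df g dg : C1 f df -> C1 g dg ->
  C1 (fun x => f x - g x) (fun x => df x - dg x).
Proof.
move=> Cf /(C1Z (-1))/(C1D Cf).
by under eq_fun do rewrite mulN1r; under [X in C1 _ X]eq_fun do rewrite mulN1r.
Qed.

Lemma C1_comp f df g dg : C1 f df -> C1 g dg ->
  C1 (fun x => g (f x)) (fun x => dg (f x) * df x).
Proof.
move=> Cf; have cf := C1_continuous Cf; move: Cf => [fdf cdf] [gdg cdg].
split=> x; first exact: (is_derive1_comp (gdg (f x)) (fdf x)).
apply: cvgM (cdf x); apply: continuous_comp; [exact: cf|exact: cdg].
Qed.

Lemma C1_pow n : exists df, C1 (fun x => x ^+ n) df.
Proof.
elim: n => [|n [df Cn]].
  by exists (fun=> 0); under eq_fun do rewrite expr0; exact: C1_cst.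
by eexists; under eq_fun do rewrite exprS; exact: C1M C1_id Cn.
Qed.

Lemma continuous_pospart : continuous (fun x => Num.max 0 x).
Proof. by move=> x; apply: continuous_max; [exact: cvg_cst|exact: cvg_id]. Qed.

(** The squared positive part is the elementary C^1 function with a cut-off
    from which all the bump functions are built. *)
Lemma C1_pospart_sqr : C1 (fun x => Num.max 0 x ^+ 2) (fun x => 2 * Num.max 0 x).
Proof.
split=> x; last by apply: cvgM; [exact: cvg_cst|exact: continuous_pospart].
have [x0|x0|->] := ltgtP x 0.
- apply: (@near_eq_is_derive _ _ _ (fun=> 0)); last first.
    by rewrite mulr0; exact: is_derive_cst.
  near=> y; rewrite max_l ?expr0n//; apply: ltW; near: y; exact: lt_nbhsl.
- apply: (@near_eq_is_derive _ _ _ (fun x => x * x)); last first.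
    apply: (@is_derive_eq _ _ _ _ _ _ _ _ (is_deriveM (is_derive_id _ _) (is_derive_id _ _))).
    by rewrite /GRing.scale/= mulr1 -mulr2n mulr_natl.
  near=> y; rewrite max_r ?expr2//; apply: ltW; near: y; exact: lt_nbhsr.
- have H : t^-1 *: (Num.max 0 (t *: (1:R) + 0) ^+ 2 - Num.max 0 (0:R) ^+ 2)
      @[t --> 0^'] --> (0 : R).
    rewrite (_ : (fun t => _) = fun t => t^-1 * Num.max 0 t ^+ 2); last first.
      by apply/funext => t; rewrite addr0 maxxx expr0n subr0 /GRing.scale/= mulr1.
    rewrite (_ : (fun t => _) = fun t => Num.max 0 t); last first.
      apply/funext => t; have [t0|t0] := ltrP 0 t; last by rewrite expr0n mulr0.
      by rewrite expr2 mulKf// gt_eqF.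
    apply: cvg_within_filter.
    by have := @continuous_pospart 0; rewrite /continuous_at maxxx.
  rewrite ?maxxx mulr0; apply: DeriveDef; first by apply/cvg_ex; exists 0.
  exact: cvg_lim H.
Unshelve. all: by end_near. Qed.

Lemma C1_within c d f df : C1 f df -> derivable_oo_LRcontinuous f c d.
Proof.
move=> Cf; have cf := C1_continuous Cf; case: Cf => fdf _; split.
- by move=> x _; exact: (@ex_derive _ _ _ _ _ _ _ (fdf x)).
- exact: (cvg_at_right_filter (cf c)).
- exact: (cvg_at_left_filter (cf d)).
Qed.

Lemma continuous_integrable_oo f a b : continuous f ->
  mu.-integrable `]a, b[ (EFin \o f).
Proof.
move=> cf; apply: (@integrableS _ _ _ mu `[a, b]) => //.
  exact: subset_itv_oo_cc.
by apply: continuous_compact_integrable; [exact: segment_compact|exact: continuous_subspaceT].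
Qed.

Lemma continuous_L2 f a b : continuous f -> L2 `]a, b[ f.
Proof.
move=> cf; split.
  by apply: measurable_funTS; exact: continuous_measurable_fun.
apply: (@continuous_integrable_oo (fun x => f x ^+ 2)) => x.
by apply: (@continuous_comp _ _ _ f (fun x => x ^+ 2)); [exact: cf|exact: exprn_continuous].
Qed.

Lemma measurable_oo a b : measurable (`]a, b[%classic : set R). Proof. by []. Qed.
Hint Resolve measurable_oo : core.

Lemma L2_cst a b c : L2 `]a, b[ (fun=> c).
Proof. by apply: continuous_L2 => x; exact: cvg_cst. Qed.

Lemma subset_oo a b c d : a <= c -> d <= b ->
  (`]c, d[%classic : set R) `<=` `]a, b[.
Proof. by move=> ac db; apply: subset_itv; rewrite bnd_simp. Qed.

Lemma L2_integrable a b p : L2 `]a, b[ p -> mu.-integrable `]a, b[ (EFin \o p).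
Proof.
move=> Lp; have := L2_ip (measurable_oo a b) Lp (L2_cst a b 1).
by congr integrable.body; apply/funext => x /=; rewrite mulr1.
Qed.

Lemma C1_integral f df c d : C1 f df -> c <= d ->
  \int[mu]_(x in `]c, d[) df x = f d - f c.
Proof.
move=> Cf; rewrite le_eqVlt => /predU1P[->|cd].
  by rewrite set_itvoo0 Rintegral_set0 subrr.
have cdf := Cf.2.
rewrite Rintegral_itv_bndo_bndc; last exact: continuous_integrable_oo.
rewrite Rintegral_itv_obnd_cbnd; last first.
  apply: (@integrableS _ _ _ mu `[c, d]) => //; first exact: subset_itv_oc_cc.
  by apply: continuous_compact_integrable; [exact: segment_compact|exact: continuous_subspaceT].
rewrite /Rintegral (@continuous_FTC2 _ df f c d) => //.
- exact: continuous_subspaceT.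
- exact: C1_within Cf.
- by move=> x _; rewrite (C1_derive1 Cf).
Qed.

Lemma C1_by_parts f df g dg c d : C1 f df -> C1 g dg -> c <= d ->
  ip `]c, d[ df g + ip `]c, d[ f dg = f d * g d - f c * g c.
Proof.
move=> Cf Cg cd; rewrite -(C1_integral (C1M Cf Cg) cd).
have cf := C1_continuous Cf; have cg := C1_continuous Cg.
by rewrite RintegralD//; apply: continuous_integrable_oo => x; apply: cvgM;
  [exact: Cf.2|exact: cg|exact: cf|exact: Cg.2].
Qed.

End ContinuouslyDifferentiable.
#[local] Hint Resolve measurable_oo : core.

(** * Test functions *)
Section TestFunctions.
Context {R : realType}.
Local Notation mu := (@lebesgue_measure R).
Implicit Types (D E : set R) (f g h u v df dg : R -> R) (a b c d x y : R).

Lemma C1_support f df al be : C1 f df ->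
  (forall x, f x != 0 -> al <= x <= be) ->
  forall x, df x != 0 -> al <= x <= be.
Proof.
move=> Cf supp x; apply: contraNT => xab.
have oC : open (~` `[al, be]%classic) by exact/closed_openC/itv_closed.
have f0 : \forall y \near x, (fun=> 0) y = f y.
  have : nbhs x (~` `[al, be]%classic).
    by apply: open_nbhs_nbhs; split => //=; rewrite in_itv; exact/negP.
  apply: filterS => y /= yab; apply/esym/eqP; apply/negPn/negP => /supp.
  by move: yab; rewrite in_itv.
have := @near_eq_derive R R R _ _ x 1 f0.
by rewrite derive_cst -derive1E (C1_derive1 Cf) => <-.
Qed.

Lemma Cc1_C1 D f : Cc1 D f -> C1 f (derive1 f).
Proof.
by move=> [df cdf _ _]; split => // x; rewrite derive1E; exact: derivableP.
Qed.

(** Compact support is handled through an enclosing segment [[al, be]], which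
    is easier to carry through constructions than a closure; [Cc1_hull] is the
    converse. *)
Lemma C1_Cc1 a b f df al be : C1 f df ->
  (forall x, f x != 0 -> al <= x <= be) -> a < al -> be < b ->
  Cc1 `]a, b[ f.
Proof.
move=> Cf supp aal beb.
have cS : closure [set x | f x != 0] `<=` `[al, be].
  rewrite [X in _ `<=` X](closure_id _).1; last exact: itv_closed.
  by apply: closureS => x /= /supp; rewrite in_itv.
split.
- by move=> x; exact: (@ex_derive _ _ _ _ _ _ _ (Cf.1 x)).
- by rewrite (C1_derive1 Cf); exact: Cf.2.
- exact: (subclosed_compact (@closed_closure _ _) (@segment_compact _ al be) cS).
- apply: subset_trans cS _ => x /=; rewrite !in_itv/= => /andP[alx xbe].
  by rewrite (lt_le_trans aal)//= (le_lt_trans xbe).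
Qed.

Lemma Cc1_hull a b f : Cc1 `]a, b[ f ->
  exists al be, [/\ a < al, be < b & forall x, f x != 0 -> al <= x <= be].
Proof.
move=> [_ _ cS SI]; set S := [set x | f x != 0] in cS SI.
have [S0|/set0P S0] := eqVneq (closure S) set0.
  (* [f] is zero: the bounds are arbitrary, and [al <= be] may fail *)
  exists (a + 1), (b - 1); split; [lra|lra|].
  by move=> x /(@subset_closure _ S); rewrite S0.
have cid D : {within D, continuous (@id R)}.
  by apply: continuous_subspaceT => x; exact: cvg_id.
have [be beS bemax] := compact_EVT_max S0 cS (cid _).
have [al alS almin] := compact_EVT_min S0 cS (cid _).
exists al, be; split.
- by have := SI _ (set_mem alS); rewrite /= in_itv/= => /andP[].
- by have := SI _ (set_mem beS); rewrite /= in_itv/= => /andP[].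
- move=> x /(@subset_closure _ S)/mem_set xS.
  by rewrite almin// bemax.
Qed.

Lemma Cc1_L2 a b f D : Cc1 D f -> L2 `]a, b[ f.
Proof. by move=> /Cc1_C1/C1_continuous cf; exact: continuous_L2. Qed.

Lemma Cc1_derive1_L2 a b f D : Cc1 D f -> L2 `]a, b[ (derive1 f).
Proof. by move=> /Cc1_C1[_ cf]; exact: continuous_L2. Qed.

Lemma Cc1S D E f : D `<=` E -> Cc1 D f -> Cc1 E f.
Proof. by move=> DE [? ? ? fD]; split => //; exact: subset_trans DE. Qed.

Lemma Cc1_out a b f x : Cc1 `]a, b[ f -> ~ `]a, b[%classic x -> f x = 0.
Proof.
move=> [_ _ _ SI] xab; apply/eqP; apply/negPn/negP => fx.
by apply: xab; apply: SI; exact: subset_closure.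
Qed.

Lemma Cc1_derive1_out a b f x : Cc1 `]a, b[ f -> ~ `]a, b[%classic x ->
  derive1 f x = 0.
Proof.
move=> Cf xab; have [al [be [aal beb supp]]] := Cc1_hull Cf.
apply/eqP; apply/negPn/negP => /(C1_support (Cc1_C1 Cf) supp)/andP[alx xbe].
by apply: xab; rewrite /= in_itv/= (lt_le_trans aal alx) (le_lt_trans xbe).
Qed.

Lemma Cc1_comb a b s f g : Cc1 `]a, b[ f -> Cc1 `]a, b[ g ->
  Cc1 `]a, b[ (fun x => s * f x + g x).
Proof.
move=> Cf Cg; have [al [be [aal beb supp]]] := Cc1_hull Cf.
have [al0 [be0 [aal0 beb0 supp0]]] := Cc1_hull Cg.
apply: (@C1_Cc1 a b _ _ (Num.min al al0) (Num.max be be0)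
  (C1D (C1Z s (Cc1_C1 Cf)) (Cc1_C1 Cg))).
- move=> x; have [fx0|/supp/andP[h1 h2] _] := eqVneq (f x) 0; last first.
    by rewrite ge_min h1 le_max h2.
  have [gx0|/supp0/andP[h1 h2] _] := eqVneq (g x) 0; last first.
    by rewrite ge_min h1 le_max h2 !orbT.
  by rewrite fx0 gx0 mulr0 addr0 eqxx.
- by rewrite lt_min aal.
- by rewrite gt_max beb.
Qed.

(** Smooth approximations of the indicator of [(c, d)]. From a C^1 function
    [th] with [0 < th <= 1] on [(c, d)] and [th = 0] elsewhere, take
    [1 - (1 - th)^n]: it stays equal to zero outside, and increases to one
    inside because [0 <= 1 - th < 1] there. *)
Lemma bump_seq c d : c < d -> exists psi : nat -> R -> R,
  [/\ forall n, exists dpsi, C1 (psi n) dpsi,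
      forall n x, 0 <= psi n x <= 1,
      forall n x, psi n x != 0 -> c < x < d &
      forall x, c < x < d -> psi ^~ x @ \oo --> (1 : R)].
Proof.
move=> cd; pose P x := Num.max 0 x ^+ 2; have CP := @C1_pospart_sqr R.
(* the factor [(d - c)^-4] normalizes [th] to have values in [[0, 1]] *)
pose th x := (d - c) ^- 4 * (P (x - c) * P (d - x)).
have [dth Cth] : exists dth, C1 th dth.
  eexists; apply: C1Z; apply: C1M; apply: C1_comp CP.
    exact: C1B C1_id (C1_cst c).
  exact: C1B (C1_cst d) C1_id.
have dc : 0 < d - c by rewrite subr_gt0.
have th_out x : ~~ (c < x < d) -> th x = 0.
  have P0 y : y <= 0 -> P y = 0 by move=> y0; rewrite /P max_l// expr0n.
  rewrite negb_and -!leNgt /th => /orP[] h.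
    by rewrite (P0 (x - c)) ?subr_le0// mul0r mulr0.
  by rewrite (P0 (d - x)) ?subr_le0// !mulr0.
have th_in x : c < x < d -> 0 < th x <= 1.
  move=> /andP[cx xd]; rewrite /th /P.
  have x1 : 0 < x - c by rewrite subr_gt0.
  have x2 : 0 < d - x by rewrite subr_gt0.
  rewrite (max_r (ltW x1)) (max_r (ltW x2)) mulr_gt0 ?invr_gt0 ?exprn_gt0 ?mulr_gt0 ?exprn_gt0//=.
  rewrite ler_pdivrMl ?exprn_gt0// mulr1 (exprD _ 2 2).
  by apply: ler_pM; rewrite ?sqr_ge0// ler_sqr ?nnegrE; lra.
have th01 x : 0 <= th x <= 1.
  have [xcd|/th_out ->] := boolP (c < x < d); last by rewrite lexx ler01.
  by have /andP[/ltW -> ->] := th_in _ xcd.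
exists (fun n x => 1 - (1 - th x) ^+ n); split.
- move=> n; have [dpow Cpow] := @C1_pow R n.
  eexists; apply: C1B (C1_cst 1) _; apply: C1_comp Cpow.
  exact: C1B (C1_cst 1) Cth.
- move=> n x; have /andP[t0 t1] := th01 x.
  have s0 : 0 <= 1 - th x by lra.
  by rewrite subr_ge0 exprn_ile1//=; [rewrite gerBl exprn_ge0|lra].
- by move=> n x; apply: contraNT => xcd; rewrite th_out ?subr0 ?expr1n ?subrr.
- move=> x /th_in/andP[t0 t1].
  have h : (fun n => (1 - th x) ^+ n) @ \oo --> (0 : R).
    by apply: cvg_expr; rewrite ger0_norm; lra.
  rewrite -[X in _ --> X]subr0; apply: cvgB => //; exact: cvg_cst.
Qed.

End TestFunctions.

(** * The fundamental lemma of the calculus of variations *)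
Section FundamentalLemma.
Context {R : realType}.
Local Notation mu := (@lebesgue_measure R).
Implicit Types (D E : set R) (f g h p q u v df dg : R -> R) (a b c d x y : R).

(** Dominated convergence along the bumps that approximate the indicator of
    [(c, d)]. *)
Lemma integral_oo_eq0 a b c d p : L2 `]a, b[ p ->
  (forall f, Cc1 `]a, b[ f -> ip `]a, b[ p f = 0) ->
  a < c -> d < b -> \int[mu]_(x in `]c, d[) p x = 0.
Proof.
move=> Lp p0 ac db.
have [dc|cd] := leP d c; first by rewrite set_itv_ge ?Rintegral_set0// bnd_simp -leNgt.
have [psi [Cpsi psi01 supp cvpsi]] := bump_seq cd.
have mI : measurable (`]a, b[%classic : set R) by [].
have mp : measurable_fun `]a, b[ p by exact: L2_meas.
have L1 : L2 `]a, b[ (fun=> 1 : R) by exact: L2_cst.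
have Ip : mu.-integrable `]a, b[ (EFin \o p).
  have := L2_ip mI Lp L1; congr integrable.body.
  by apply/funext => x /=; rewrite mulr1.
have Cc n : Cc1 `]a, b[ (psi n).
  have [dpsi H] := Cpsi n; apply: (C1_Cc1 H _ ac db) => x /supp/andP[cx xd].
  by rewrite !ltW.
have mind : measurable_fun `]a, b[ (\1_`]c, d[%classic : R -> R).
  by apply: measurable_funTS; exact: measurable_indic.
have cv : (fun n => \int[mu]_(x in `]a, b[) (p x * psi n x)%:E)%E @ \oo -->
    (\int[mu]_(x in `]a, b[) (p x * \1_`]c, d[%classic x)%:E)%E.
  have [//||||//|//] := @dominated_convergence _ _ _ mu `]a, b[ mI
    (fun n x => (p x * psi n x)%:E) (fun x => (p x * \1_`]c, d[%classic x)%:E)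
    (fun x => `|p x|%:E).
  - move=> n; apply/measurable_EFinP/measurable_funM => //.
    exact: L2_meas (@Cc1_L2 _ a b _ _ (Cc n)).
  - exact/measurable_EFinP/measurable_funM.
  - apply: aeW => x _; apply: cvg_EFin; first exact: nearW.
    apply: cvgnM; first exact: cvgn_cst.
    rewrite indicE; have [/set_mem/=|/negP xcd] := boolP (x \in `]c, d[%classic).
      by rewrite in_itv/=; exact: cvpsi.
    apply: (eq_cvgn _ (cvgn_cst (0 : R))) => n; apply/esym/eqP/negPn/negP => /supp h.
    by apply: xcd; rewrite inE/= in_itv.
  - exact: (integrable_norm Ip).
  - apply: aeW => x n _; have /andP[psi0 psi1] := psi01 n x.
    by rewrite lee_fin normrM (ger0_norm psi0) ler_piMr.
have h : (\int[mu]_(x in `]a, b[) (p x * \1_`]c, d[%classic x)%:E = 0)%E.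
  have E n : (\int[mu]_(x in `]a, b[) (p x * psi n x)%:E = 0)%E.
    rewrite -[LHS]fineK; first by congr EFin; exact: p0 (Cc n).
    by apply: integrable_fin_num => //; apply: L2_ip => //; exact: Cc1_L2 (Cc n).
  move: cv; rewrite (funext E) => cv.
  by apply: (cvg_unique _ cv) => //; exact: cvg_cst.
transitivity (ip `]a, b[ p \1_`]c, d[%classic); last by rewrite /ip /Rintegral h.
rewrite (@ip_sub _ _ `]c, d[%classic).
- by apply: eq_Rintegral => x xcd; rewrite indicE xcd mulr1.
- by move=> x _ xcd; right; rewrite indicE memNset.
- apply: subset_itv; rewrite bnd_simp; exact: ltW.
Qed.


(** At a Lebesgue point [x], the function [p] is the derivative of its integral
    from a point [c] close to [x], and that integral is zero. *)
Lemma ae_eq0_of_integral_oo a b p : mu.-integrable `]a, b[ (EFin \o p) ->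
  (forall c d, a < c -> d < b -> \int[mu]_(x in `]c, d[) p x = 0) ->
  {ae mu, forall x, `]a, b[%classic x -> p x = 0}.
Proof.
move=> Ip p0; pose f := p \_ `]a, b[.
have If : mu.-integrable setT (EFin \o f).
  by rewrite /f -restrict_EFin -integrable_mkcond.
have locf : locally_integrable setT f by exact: integrable_locally.
apply: aeS (lebesgue_differentiation locf) => x lx /= /[dup] xab.
rewrite in_itv/= => /andP[ax xb].
pose c := (a + x) / 2; pose u := (x + b) / 2.
have ac : a < c by rewrite /c; lra.
have cx : c < x by rewrite /c; lra.
have xu : x < u by rewrite /u; lra.
have ub : u < b by rewrite /u; lra.
have Icu : mu.-integrable [set` Interval (BRight c) (BRight u)] (EFin \o f).
  exact: (@integrableS _ _ _ mu setT).
have [] := @FTC1_lebesgue_pt R f (BRight c) x u xu Icu _ lx.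
  exact: cx.
have -> : f x = p x by rewrite /f patchE mem_set.
move=> _ <-.
have F0 : \forall y \near x, (fun=> 0) y = \int[mu]_(t in `]c, y]) f t.
  have : \forall y \near x, y < u by exact: lt_nbhsl.
  apply: filterS => y yu; apply/esym.
  rewrite -Rintegral_itv_bndo_bndc; last exact: (@integrableS _ _ _ mu setT).
  rewrite -[RHS](p0 c y ac (lt_trans yu ub)); apply: eq_Rintegral => z.
  rewrite inE/= in_itv/= => /andP[cz zy]; rewrite /f patchE mem_set//= in_itv/=.
  by rewrite (lt_trans ac cz) (lt_trans zy (lt_trans yu ub)).
by rewrite derive1E -(near_eq_derive _ F0) derive_cst.
Qed.

End FundamentalLemma.

(** * Weak derivatives *)
Section WeakDerivative.
Context {R : realType}.
Local Notation mu := (@lebesgue_measure R).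
Implicit Types (D E : set R) (f g h p q u v df dg : R -> R) (a b c d x y : R).

Lemma fundamental_lemma a b p : L2 `]a, b[ p ->
  (forall f, Cc1 `]a, b[ f -> ip `]a, b[ p f = 0) ->
  {ae mu, forall x, `]a, b[%classic x -> p x = 0}.
Proof.
move=> Lp p0; apply: ae_eq0_of_integral_oo; first exact: L2_integrable.
by move=> c d ac db; apply: integral_oo_eq0 Lp p0 ac db.
Qed.

Lemma ip_one a b : a <= b -> ip `]a, b[ (fun=> 1) (fun=> 1) = b - a :> R.
Proof.
move=> ab; rewrite -(C1_integral (C1_id) ab).
by apply: eq_Rintegral => x _; rewrite mulr1.
Qed.

(** The primitive that vanishes to the left of the support of [k] is constant to
    its right, and the constant is the integral of [k], that is, zero. *)
Lemma Cc1_primitive a b k : Cc1 `]a, b[ k ->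
  \int[mu]_(x in `]a, b[) k x = 0 ->
  exists2 f, Cc1 `]a, b[ f & derive1 f = k.
Proof.
move=> Ck k0; have ck := C1_continuous (Cc1_C1 Ck).
have [al [be [aal beb supp]]] := Cc1_hull Ck.
have Ik : mu.-integrable setT (EFin \o k).
  have : mu.-integrable `[al, be] (EFin \o k).
    by apply: continuous_compact_integrable; [exact: segment_compact|exact: continuous_subspaceT].
  rewrite integrable_mkcond//; congr integrable.body; apply/funext => x.
  rewrite patchE; case: ifPn => //=; rewrite notin_setE/= in_itv/= => /negP xab.
  by congr EFin; apply/esym/eqP; apply: contraNT xab; exact: supp.
pose F x := \int[mu]_(t in `]-oo, x]) k t.
have IkS D : measurable D -> mu.-integrable D (EFin \o k).
  by move=> mD; exact: (@integrableS _ _ _ mu setT).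
have CF : C1 F k.
  split=> // x.
  have [] := @continuous_FTC1 R k -oo%O x (x + 1) _ (IkS _ (measurable_itv _)) _ (ck x).
  - by rewrite ltrDl.
  - by rewrite ltNyr.
  - by move=> dF F'; apply: DeriveDef => //; rewrite -derive1E.
exists F; last exact: C1_derive1.
apply: (C1_Cc1 CF _ aal beb) => x.
rewrite -[_ && _]negbK negb_and -!ltNge; apply: contra => /orP[xal|bex].
  apply/eqP; transitivity (\int[mu]_(t in `]-oo, x]) (0 : R)); last first.
    by rewrite Rintegral_cst// mul0r.
  apply: eq_Rintegral => y; rewrite inE/= in_itv/= => yx.
  apply/eqP; apply: contraTT xal => /supp/andP[aly _].
  by rewrite -leNgt (le_trans aly).
rewrite /F -[X in _ == X]k0; apply/eqP.
rewrite Rintegral_mkcond [RHS]Rintegral_mkcond; congr Rintegral; apply/funext => y.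
rewrite !patchE; have [->|/supp/andP[aly ybe]] := eqVneq (k y) 0; first by rewrite !if_same.
rewrite !mem_set//= in_itv/=.
  by rewrite (lt_le_trans aal aly) (le_lt_trans ybe beb).
exact: ltW (le_lt_trans ybe bex).
Qed.

(** If [h0] is a test function with [int h0 <> 0], any test function [h] differs
    by a multiple [s h0] from one with integral zero, which is a derivative of
    a test function by [Cc1_primitive]. Hence [<q, h> = s <q, h0>], which says
    that [q - C] is orthogonal to [h] for [C = <q, h0> / int h0]. *)
Lemma du_bois_reymond a b q : a < b -> L2 `]a, b[ q ->
  (forall f, Cc1 `]a, b[ f -> ip `]a, b[ q (derive1 f) = 0) ->
  exists C, {ae mu, forall x, `]a, b[%classic x -> q x = C}.
Proof.
move=> ab Lq q0; have mI : measurable (`]a, b[%classic : set R) by [].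
have L1 := L2_cst a b 1; pose one : R -> R := fun=> 1.
(* otherwise the constant function one would vanish by the fundamental lemma *)
have [h0 [Ch0 h00]] : exists h0, Cc1 `]a, b[ h0 /\ ip `]a, b[ one h0 != 0.
  apply: contrapT => /forallNP no.
  have /(fundamental_lemma L1) : forall f, Cc1 `]a, b[ f -> ip `]a, b[ one f = 0.
    by move=> f Cf; apply/eqP/negPn/negP => f0; apply: (no f).
  have L0 : L2 `]a, b[ (fun=> 0 : R) by exact: L2_cst.
  move=> /(ip_ae mI L1 L0 L1); rewrite (ip_one (ltW ab)).
  by rewrite ip0l => /eqP; rewrite subr_eq0 gt_eqF.
pose C := ip `]a, b[ q h0 / ip `]a, b[ one h0.
have LC : L2 `]a, b[ (fun=> C) by exact: L2_cst.
exists C.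
suff : {ae mu, forall x, `]a, b[%classic x -> q x - C = 0}.
  by apply: aeS => x qC /qC/eqP; rewrite subr_eq0 => /eqP.
apply: (fundamental_lemma (L2B mI Lq LC)) => h Ch.
have Lh := @Cc1_L2 _ a b _ _ Ch; have Lh0 := @Cc1_L2 _ a b _ _ Ch0.
pose s := ip `]a, b[ one h / ip `]a, b[ one h0.
have Lsh0 := L2Z s mI Lh0.
have Ck : Cc1 `]a, b[ (fun x => h x - s * h0 x).
  have := Cc1_comb (- s) Ch0 Ch; congr Cc1.
  by apply/funext => x; rewrite mulNr addrC.
have [|f Cf f'] := Cc1_primitive Ck.
  transitivity (ip `]a, b[ one (fun x => h x - s * h0 x)).
    by apply: eq_Rintegral => x _; rewrite mul1r.
  by rewrite ipBr// ipZr// /s divfK// subrr.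
have := q0 _ Cf; rewrite f' ipBr// ipZr// => /eqP; rewrite subr_eq0 => /eqP qh.
rewrite ipBl// qh (_ : (fun=> C) = fun x => C * one x); last first.
  by apply/funext => x; rewrite mulr1.
by rewrite ipZl// /s /C; field.
Qed.

(** [wderiv] picks one weak derivative among many. Working with a pair leaves
    the choice of the representative open; [wpair_wderiv] goes back. *)
Definition wpair D u g : Prop := [/\ L2 D u, L2 D g & is_wderiv D u g].

Lemma wderiv_unique a b u g h : wpair `]a, b[ u g -> wpair `]a, b[ u h ->
  {ae mu, forall x, `]a, b[%classic x -> g x = h x}.
Proof.
move=> [_ Lg ug] [_ Lh uh]; have mI : measurable (`]a, b[%classic : set R) by [].
suff : {ae mu, forall x, `]a, b[%classic x -> g x - h x = 0}.
  by apply: aeS => x gh /gh/eqP; rewrite subr_eq0 => /eqP.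
apply: (fundamental_lemma (L2B mI Lg Lh)) => f Cf.
have Lf := @Cc1_L2 _ a b _ _ Cf.
rewrite ipBl//; apply/eqP; rewrite subr_eq0 -eqr_opp; apply/eqP.
by rewrite -(uh _ Cf); apply/esym; exact: ug.
Qed.

Lemma H1_wpair D u : H1 D u -> wpair D u (wderiv D u).
Proof.
move=> [Lu [g [Lg ug]]].
have [] : [set h | L2 D h /\ is_wderiv D u h] (wderiv D u).
  by apply: xgetPex; exists g.
by split.
Qed.

Lemma wpair_H1 D u g : wpair D u g -> H1 D u.
Proof. by move=> [Lu Lg ug]; split => //; exists g. Qed.

Lemma wpair_wderiv a b u g : wpair `]a, b[ u g ->
  {ae mu, forall x, `]a, b[%classic x -> wderiv `]a, b[ u x = g x}.
Proof. by move=> ug; apply: (wderiv_unique _ ug); exact/H1_wpair/(wpair_H1 ug). Qed.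

Lemma C1_wpair a b f df : C1 f df -> wpair `]a, b[ f df.
Proof.
move=> Cf; split; [exact/continuous_L2/(C1_continuous Cf)|exact/continuous_L2/Cf.2|].
move=> h Ch; have [ab|ba] := leP a b; last first.
  by rewrite set_itv_ge ?Rintegral_set0 ?oppr0// bnd_simp -leNgt ltW.
have out x : x = a \/ x = b -> h x = 0.
  by move=> xab; apply: (Cc1_out Ch); rewrite /= in_itv/=; case: xab => ->; rewrite ltxx ?andbF.
have := C1_by_parts Cf (Cc1_C1 Ch) ab.
rewrite (out a) ?(out b); [|by right|by left]; rewrite !mulr0 subrr => /eqP.
by rewrite addrC addr_eq0 => /eqP.
Qed.

(** A test function on a smaller interval is one on the larger. *)
Lemma wpairS a b c d u g : a <= c -> d <= b ->
  wpair `]a, b[ u g -> wpair `]c, d[ u g.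
Proof.
move=> ac db [Lu Lg ug].
have sub := subset_oo ac db.
split; [exact: L2S Lu|exact: L2S Lg|] => h Ch.
have := ug _ (Cc1S sub Ch); rewrite -/(ip _ _ _) -/(ip _ _ _) => E.
rewrite -/(ip _ _ _) -/(ip _ _ _) -(ip_sub _ sub) => [|x _ xcd]; last first.
  by right; exact: (Cc1_derive1_out Ch).
by rewrite E (ip_sub _ sub)// => x _ xcd; right; exact: (Cc1_out Ch).
Qed.

Lemma wderiv0_const a b u : a < b -> L2 `]a, b[ u ->
  is_wderiv `]a, b[ u (fun=> 0) ->
  exists C, {ae mu, forall x, `]a, b[%classic x -> u x = C}.
Proof.
move=> ab Lu u0; apply: du_bois_reymond => // h /u0; rewrite /ip => ->.
by rewrite -/(ip _ _ h) ip0l oppr0.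
Qed.

End WeakDerivative.

(** * Functions vanishing at the endpoints *)
Section VanishingTrace.
Context {R : realType}.
Local Notation mu := (@lebesgue_measure R).
Implicit Types (D E : set R) (f g h p q u v df dg : R -> R) (a b c d x y : R).
Local Notation one := (fun=> 1 : R).

Definition H10seq D u g (phi : nat -> R -> R) : Prop :=
  [/\ forall n, Cc1 D (phi n), L2cvg D phi u &
      L2cvg D (fun n => derive1 (phi n)) g].

(** The closure of the graph of the derivative on test functions: [u] belongs to
    [H10] and [g] is a weak derivative of it, see [H10_H10pair], [H10pair_H10]
    and [H10pair_wpair]. Linear combinations and extension by zero are immediate
    on this form. *)
Definition H10pair D u g : Prop :=
  [/\ L2 D u, L2 D g & exists phi, H10seq D u g phi].

Lemma ip_sqr D f : \int[mu]_(x in D) f x ^+ 2 = ip D f f.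
Proof. by apply: eq_Rintegral => x _; rewrite expr2. Qed.

Lemma L2cvg_ae a b (phi : nat -> R -> R) u v : (forall n, L2 `]a, b[ (phi n)) ->
  L2 `]a, b[ u -> L2 `]a, b[ v ->
  {ae mu, forall x, `]a, b[%classic x -> u x = v x} ->
  L2cvg `]a, b[ phi u -> L2cvg `]a, b[ phi v.
Proof.
move=> Lphi Lu Lv uv; apply: eq_cvgn => n.
have Lpu := L2B (measurable_oo a b) (Lphi n) Lu; have Lpv := L2B (measurable_oo a b) (Lphi n) Lv.
have E : {ae mu, forall x, `]a, b[%classic x -> phi n x - u x = phi n x - v x}.
  by apply: aeS uv => x uv /uv ->.
by rewrite (ip_ae _ Lpu Lpv Lpu E)// ipC (ip_ae _ Lpu Lpv Lpv E).
Qed.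

Lemma H10_H10pair a b u : H10 `]a, b[ u -> H10pair `]a, b[ u (wderiv `]a, b[ u).
Proof.
move=> [H1u [phi [Cphi cv]]]; have [Lu Lg ug] := H1_wpair H1u.
split => //; exists phi; split => //; apply: (squeeze0 _ cv) => n; rewrite !ip_sqr.
  by rewrite ip_ge0 lerDl ip_ge0.
by rewrite ip_ge0 lerDr ip_ge0.
Qed.

Lemma H10seqS a b c d u g phi : a <= c -> d <= b ->
  L2 `]a, b[ u -> L2 `]a, b[ g -> H10seq `]a, b[ u g phi ->
  [/\ L2 `]c, d[ u, L2 `]c, d[ g, L2cvg `]c, d[ phi u &
      L2cvg `]c, d[ (fun n => derive1 (phi n)) g].
Proof.
move=> ac db Lu Lg [Cphi phiu phig].
have sub := subset_oo ac db.
split; [exact: L2S Lu|exact: L2S Lg| |].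
  apply: (L2cvgS (measurable_oo a b) _ sub) => // n; exact: Cc1_L2.
apply: (L2cvgS (measurable_oo a b) _ sub) => // n; exact: Cc1_derive1_L2.
Qed.

(** Integration by parts on a subinterval. The boundary terms involve the
    approximating functions, since [u] itself is only known almost
    everywhere; with [f = 1] they converge to the nodal values of [u]. *)
Lemma H10seq_by_parts a b c d u g f df phi : a <= c -> c <= d -> d <= b ->
  L2 `]a, b[ u -> L2 `]a, b[ g -> H10seq `]a, b[ u g phi -> C1 f df ->
  (fun n => phi n d * f d - phi n c * f c) @ \oo -->
    (ip `]c, d[ g f + ip `]c, d[ u df : R).
Proof.
move=> ac cd db Lu Lg sphi Cf; case: (sphi) => Cphi _ _.
have [Lu' Lg' phiu phig] := H10seqS ac db Lu Lg sphi.
have Lf : L2 `]c, d[ f by exact/continuous_L2/(C1_continuous Cf).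
have Ldf : L2 `]c, d[ df by exact/continuous_L2/Cf.2.
have h1 := ip_cvg (measurable_oo c d) (fun n => @Cc1_L2 _ c d _ _ (Cphi n)) Lu'
  (fun=> Ldf) Ldf phiu (L2cvg_cst _ _).
have h2 := ip_cvg (measurable_oo c d) (fun n => @Cc1_derive1_L2 _ c d _ _ (Cphi n)) Lg'
  (fun=> Lf) Lf phig (L2cvg_cst _ _).
apply: eq_cvgn (cvgnD h2 h1) => n.
by rewrite (C1_by_parts (Cc1_C1 (Cphi n)) Cf cd).
Qed.

Lemma Cc1_endpoints a b f : Cc1 `]a, b[ f -> f a = 0 /\ f b = 0.
Proof.
by move=> Cf; split; apply: (Cc1_out Cf); rewrite /= in_itv/= ltxx ?andbF.
Qed.

(** On the whole interval the boundary terms vanish, even though [f] does not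
    vanish at the endpoints. *)
Lemma H10pair_C1 a b u g f df : a <= b -> H10pair `]a, b[ u g -> C1 f df ->
  ip `]a, b[ g f + ip `]a, b[ u df = 0.
Proof.
move=> ab [Lu Lg [phi sphi]] Cf.
have cv := H10seq_by_parts (lexx a) ab (lexx b) Lu Lg sphi Cf.
apply: (cvg_unique _ cv) => //; apply: (eq_cvgn _ (cvgn_cst (0:R))) => n.
by have [-> ->] := Cc1_endpoints (let: And3 C _ _ := sphi in C n); rewrite !mul0r subrr.
Qed.

Lemma H10pair_int0 a b u g : a <= b -> H10pair `]a, b[ u g -> ip `]a, b[ g one = 0.
Proof.
move=> ab ug; rewrite -[RHS](H10pair_C1 ab ug (C1_cst 1)).
rewrite [X in _ + X](_ : _ = 0) ?addr0//.
exact: ip0r.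
Qed.

Lemma H10pair_wpair a b u g : a <= b -> H10pair `]a, b[ u g -> wpair `]a, b[ u g.
Proof.
move=> ab ug; case: (ug) => Lu Lg _; split => // f /Cc1_C1 Cf.
by apply/eqP; rewrite -addr_eq0 addrC; apply/eqP; exact: H10pair_C1 Cf.
Qed.

Lemma H10pair_H10 a b u g : a <= b -> H10pair `]a, b[ u g -> H10 `]a, b[ u.
Proof.
move=> ab ug; have wug := H10pair_wpair ab ug.
have H1u := wpair_H1 wug; split => //.
have [_ Lw _] := H1_wpair H1u.
have := wpair_wderiv wug; case: ug => Lu Lg [phi [Cphi cu cg]] wg.
exists phi; split => //.
have cw : L2cvg `]a, b[ (fun n => derive1 (phi n)) (wderiv `]a, b[ u).
  apply: L2cvg_ae cg => //; first by move=> n; exact: Cc1_derive1_L2.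
  by apply: aeS wg => x wg /wg.
have := cvgnD cu cw; rewrite addr0; apply: eq_cvgn => n.
by rewrite !ip_sqr.
Qed.

Lemma Cc1_H10pair a b f : Cc1 `]a, b[ f -> H10pair `]a, b[ f (derive1 f).
Proof.
move=> Cf; split; [exact: Cc1_L2 Cf|exact: Cc1_derive1_L2 Cf|].
by exists (fun=> f); split => //; exact: L2cvg_cst.
Qed.

Lemma H10pair_comb a b s u g v h : H10pair `]a, b[ u g -> H10pair `]a, b[ v h ->
  H10pair `]a, b[ (fun x => s * u x + v x) (fun x => s * g x + h x).
Proof.
move=> [Lu Lg [phi [Cphi phiu phig]]] [Lv Lh [psi [Cpsi psiv psih]]].
split; [by apply: L2D => //; exact: L2Z|by apply: L2D => //; exact: L2Z|].
have C n : C1 (fun x => s * phi n x + psi n x)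
    (fun x => s * derive1 (phi n) x + derive1 (psi n) x).
  exact: C1D (C1Z s (Cc1_C1 (Cphi n))) (Cc1_C1 (Cpsi n)).
exists (fun n x => s * phi n x + psi n x); split.
- by move=> n; exact: Cc1_comb.
- by apply: L2cvgD => // n; exact: Cc1_L2.
- rewrite (_ : (fun n => _) = fun n x => s * derive1 (phi n) x + derive1 (psi n) x).
    by apply: L2cvgD => // n; exact: Cc1_derive1_L2.
  by apply/funext => n; rewrite (C1_derive1 (C n)).
Qed.

Lemma H10pair0 a b : H10pair `]a, b[ (fun=> 0) (fun=> 0).
Proof.
have C0 : C1 (fun=> 0 : R) (fun=> 0) := C1_cst 0.
rewrite -[X in H10pair _ _ X](C1_derive1 C0); apply: Cc1_H10pair.
by apply: (@C1_Cc1 _ a b _ _ (a + 1) (b - 1) C0); [move=> x; rewrite eqxx|lra|lra].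
Qed.

Lemma H10pair_sum a b (n : nat) (s : 'I_n -> R) (u g : 'I_n -> R -> R) :
  (forall i, H10pair `]a, b[ (u i) (g i)) ->
  H10pair `]a, b[ (fun x => \sum_(i < n) s i * u i x)
                  (fun x => \sum_(i < n) s i * g i x).
Proof.
move=> ug; elim: (index_enum _) => [|i r IH].
  have E (w : 'I_n -> R -> R) : (fun x => \sum_(i <- [::]) s i * w i x) = fun=> 0.
    by apply/funext => x; rewrite big_nil.
  by rewrite !E; exact: H10pair0.
have E (w : 'I_n -> R -> R) : (fun x => \sum_(i <- i :: r) s i * w i x) =
    fun x => s i * w i x + \sum_(i <- r) s i * w i x.
  by apply/funext => x; rewrite big_cons.
by rewrite !E; exact: H10pair_comb.
Qed.

(** The same approximating sequence works on the larger interval. *)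
Lemma H10pair_extend a b c d u g : a <= c -> d <= b ->
  (forall x, ~ `]c, d[%classic x -> u x = 0) ->
  H10pair `]c, d[ u g -> H10pair `]a, b[ u (g \_ `]c, d[).
Proof.
move=> ac db u0 [Lu Lg [phi [Cphi phiu phig]]].
have sub := subset_oo ac db.
have g0 x : ~ `]c, d[%classic x -> (g \_ `]c, d[) x = 0.
  by move=> xcd; rewrite patchE memNset.
have gE x : `]c, d[%classic x -> (g \_ `]c, d[) x = g x.
  by move=> xcd; rewrite patchE mem_set.
have ext f : L2 `]c, d[ f -> (forall x, ~ `]c, d[%classic x -> f x = 0) -> L2 `]a, b[ f.
  move=> [mf f2] f0; have fE : f = f \_ `]c, d[.
    apply/funext => x; rewrite patchE; case: ifPn => //; rewrite notin_setE; exact: f0.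
  split; first by rewrite fE; apply: measurable_funTS; apply/(measurable_restrictT _ _).1.
  apply: (@integrableS _ _ _ mu setT) => //.
  move: f2; rewrite (@integrable_mkcond _ _ _ mu _ _ (measurable_oo c d)).
  congr integrable.body; apply/funext => x.
  rewrite patchE; case: ifPn => //; rewrite notin_setE => /f0 ->.
  by rewrite expr0n.
split.
- exact: ext.
- by apply: ext => //; apply: eq_L2 Lg => // x /gE.
exists phi; split.
- by move=> n; exact: Cc1S sub (Cphi n).
- apply: eq_cvgn phiu => n; apply/esym/ip_sub => // x _ xcd; left.
  by rewrite u0// subr0; exact: Cc1_out (Cphi n) xcd.
- apply: eq_cvgn phig => n; rewrite (@ip_sub _ `]a, b[ `]c, d[%classic) => [|x _ xcd|//].
    by apply: eq_Rintegral => x /set_mem xcd; rewrite gE.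
  by left; rewrite g0// subr0; exact: Cc1_derive1_out (Cphi n) xcd.
Qed.

End VanishingTrace.

(** * Continuous representatives and nodal values *)
Section ContinuousRepresentative.
Context {R : realType}.
Local Notation mu := (@lebesgue_measure R).
Implicit Types (D E : set R) (f g h p q u v df dg : R -> R) (a b c d x y : R).
Local Notation one := (fun=> 1 : R).

(** If [f x <> 0], then [f] is nonzero on a ball around [x], which has positive
    measure. *)
Lemma continuous_ae_eq0 a b f x : a < x < b -> {for x, continuous f} ->
  {ae mu, forall y, `]a, b[%classic y -> f y = 0} -> f x = 0.
Proof.
move=> xab cf f0; apply: contrapT => /eqP fx0.
have nf : \forall y \near x, f y != 0 by exact: cvgr_neq0 cf fx0.
have nI : \forall y \near x, `]a, b[%classic y.
  have oI : open (`]a, b[%classic : set R) by exact: interval_open.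
  by apply: open_nbhs_nbhs; split => //=; rewrite in_itv.
have [e /= e0 be] := (nbhs_ballP _ _).1 (filterI nf nI).
have : mu.-negligible (`]x - e, x + e[%classic : set R).
  apply: negligibleS f0 => y; rewrite -ball_itv => /be[fy yab] /(_ yab) /eqP.
  by rewrite (negbTE fy).
move/negligibleP => /(_ (measurable_oo _ _)) /eqP.
rewrite [X in X == _](lebesgue_measure_itv `]x - e, x + e[)/= lte_fin ifT; last lra.
by rewrite -EFinD eqe => /eqP; lra.
Qed.

(** When [g] is a derivative of a [u] vanishing at [a], this is the continuous
    representative of [u], see [ae_eq_prim] and [prim_point_value]. It is an
    inner product with the constant one, so that it is linear in [g] and
    continuous for the convergence in the mean square. *)
Definition prim a g x := ip `]a, x[ g one.

Section PrimitiveOfPair.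
Variables (a b : R) (u g : R -> R).
Hypothesis ug : H10pair `]a, b[ u g.

Lemma prim_cvg phi x : a <= x -> x <= b -> H10seq `]a, b[ u g phi ->
  (phi ^~ x) @ \oo --> (prim a g x : R).
Proof.
move=> ax xb sphi; case: ug => Lu Lg _.
have := H10seq_by_parts (lexx a) ax xb Lu Lg sphi (C1_cst 1).
rewrite [X in _ + X](_ : _ = 0) ?addr0; last first.
  exact: ip0r.
apply: eq_cvgn => n; case: sphi => /(_ n)/Cc1_endpoints[-> _] _ _.
by rewrite mul0r subr0 mulr1.
Qed.

Lemma prim_increment c d : a <= c -> c <= d -> d <= b ->
  ip `]c, d[ g one = prim a g d - prim a g c.
Proof.
move=> ac cd db; case: ug => Lu Lg [phi sphi].
have := H10seq_by_parts ac cd db Lu Lg sphi (C1_cst 1).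
rewrite [X in _ + X](_ : _ = 0) ?addr0 => [cv|]; last first.
  exact: ip0r.
apply: (cvg_unique _ cv) => //.
have hd := prim_cvg (le_trans ac cd) db sphi.
have hc := prim_cvg ac (le_trans cd db) sphi.
have := cvgnD hd (cvgnM (cvgn_cst (-1)) hc); rewrite mulN1r.
by apply: eq_cvgn => n; rewrite !mulr1 mulN1r.
Qed.

Lemma prim_left : prim a g a = 0.
Proof. by rewrite /prim /ip set_itvoo0 Rintegral_set0. Qed.

Lemma prim_right : a <= b -> prim a g b = 0.
Proof. by move=> ab; exact: H10pair_int0 ug. Qed.

(** The limit of [int_c^d phi_n phi_n' = (phi_n(d)^2 - phi_n(c)^2) / 2]. *)
Lemma prim_energy c d : a <= c -> c <= d -> d <= b ->
  ip `]c, d[ u g = (prim a g d ^+ 2 - prim a g c ^+ 2) / 2.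
Proof.
move=> ac cd db; case: ug => Lu Lg [phi sphi].
have [Lu' Lg' phiu phig] := H10seqS ac db Lu Lg sphi.
have Cphi n : Cc1 `]a, b[ (phi n) by case: sphi.
have cv := ip_cvg (measurable_oo c d) (fun n => @Cc1_L2 _ c d _ _ (Cphi n)) Lu'
  (fun n => @Cc1_derive1_L2 _ c d _ _ (Cphi n)) Lg' phiu phig.
apply: (cvg_unique _ cv) => //.
have hd := prim_cvg (le_trans ac cd) db sphi.
have hc := prim_cvg ac (le_trans cd db) sphi.
have := cvgnM (cvgnD (cvgnM hd hd) (cvgnM (cvgn_cst (-1)) (cvgnM hc hc))) (cvgn_cst 2^-1).
rewrite mulN1r -!expr2; apply: eq_cvgn => n.
rewrite mulN1r -(C1_by_parts (Cc1_C1 (Cphi n)) (Cc1_C1 (Cphi n)) cd).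
by rewrite [X in X + _]ipC; field.
Qed.

(** Hoelder continuity of exponent one half, by Cauchy-Schwarz. *)
Lemma prim_dist c d : a <= c -> c <= d -> d <= b ->
  (prim a g d - prim a g c) ^+ 2 <= ip `]a, b[ g g * (d - c).
Proof.
move=> ac cd db; rewrite -prim_increment//; case: ug => _ Lg _.
have sub := subset_oo ac db.
have Lg' := L2S (measurable_oo a b) (measurable_oo c d) sub Lg.
apply: le_trans (cauchy_schwarz (measurable_oo c d) Lg' (L2_cst c d 1)) _.
by rewrite ip_one// ler_wpM2r ?subr_ge0// ip_le_sub.
Qed.

Lemma prim_continuous x : a < x < b -> {for x, continuous (prim a g)}.
Proof.
move=> /andP[ax xb]; set G := ip `]a, b[ g g.
have G0 : 0 <= G by exact: ip_ge0.
apply/cvgrPdist_le => e e0; near=> y.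
have ay : a < y by near: y; exact: lt_nbhsr.
have yb : y < b by near: y; exact: lt_nbhsl.
rewrite -(@ler_pXn2r _ 2)// ?nnegrE; last exact: ltW.
rewrite real_normK ?num_real//.
have H : (prim a g x - prim a g y) ^+ 2 <= G * `|x - y|.
  have [xy|yx] := leP x y.
    rewrite distrC ger0_norm ?subr_ge0// -sqrrN opprB.
    by apply: prim_dist => //; exact: ltW.
  by rewrite gtr0_norm ?subr_gt0//; apply: prim_dist; exact: ltW.
apply: (le_trans H); apply: (@le_trans _ _ ((G + 1) * `|x - y|)).
  by rewrite ler_wpM2r// lerDl.
rewrite -ler_pdivlMl ?ltr_wpDl//; near: y.
have e1 : 0 < (G + 1)^-1 * e ^+ 2 by rewrite mulr_gt0 ?invr_gt0 ?exprn_gt0 ?ltr_wpDl.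
by apply: cvgr_dist_le => //; exact: cvg_id.
Unshelve. all: by end_near. Qed.

Lemma prim_L2 : a <= b -> L2 `]a, b[ (prim a g).
Proof.
move=> ab; have mt : measurable_fun `]a, b[ (prim a g).
  apply: open_continuous_measurable_fun; first exact: interval_open.
  by move=> x; rewrite inE/= in_itv/=; exact: prim_continuous.
split => //; pose C := ip `]a, b[ g g * (b - a).
have LC : L2 `]a, b[ (fun=> C) by exact: L2_cst.
apply: (le_integrable_ae (measurable_oo a b) _ (L2_integrable LC)).
  exact: (measurable_funX 2 mt).
apply: aeW => x /=; rewrite in_itv/= => /andP[/ltW ax /ltW xb].
rewrite !ger0_norm ?sqr_ge0 ?mulr_ge0 ?ip_ge0 ?subr_ge0//.
have := prim_dist (lexx a) ax xb; rewrite prim_left subr0 => /le_trans; apply.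
by rewrite ler_wpM2l ?ip_ge0// lerD2r.
Qed.

(** Applied to [phi_n' - g], Cauchy-Schwarz gives
    [(phi_n(x) - prim g x)^2 <= (b - a) |phi_n' - g|^2] for all [x], so [phi_n]
    converges to [prim g] as well as to [u]. *)
Lemma ae_eq_prim : a <= b -> {ae mu, forall x, `]a, b[%classic x -> u x = prim a g x}.
Proof.
move=> ab; case: ug => Lu Lg [phi sphi]; have Lt := prim_L2 ab.
case: (sphi) => Cphi phiu phig.
have Lphi n := @Cc1_L2 _ a b _ _ (Cphi n).
apply: (L2cvg_unique (measurable_oo a b) Lphi Lu Lt phiu).
pose e n := ip `]a, b[ (fun x => derive1 (phi n) x - g x) (fun x => derive1 (phi n) x - g x).
have cv : (fun n => e n * (b - a) * (b - a)) @ \oo --> (0 : R).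
  by have := cvgnM (cvgnM phig (cvgn_cst (b - a))) (cvgn_cst (b - a)); rewrite !mul0r.
apply: (squeeze0 _ cv) => n; rewrite ip_ge0/=.
have Le : L2 `]a, b[ (fun x => derive1 (phi n) x - g x).
  by apply: L2B => //; exact: Cc1_derive1_L2 (Cphi n).
have bnd x : `]a, b[%classic x -> (phi n x - prim a g x) ^+ 2 <= e n * (b - a).
  rewrite /= in_itv/= => /andP[/ltW ax /ltW xb].
  have sub := subset_oo (lexx a) xb.
  have -> : phi n x - prim a g x = ip `]a, x[ (fun x => derive1 (phi n) x - g x) one.
    rewrite ipBl//; [|exact: Cc1_derive1_L2 (Cphi n)|exact: L2S Lg|exact: L2_cst].
    have := C1_integral (Cc1_C1 (Cphi n)) ax; rewrite (Cc1_endpoints (Cphi n)).1 subr0 => <-.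
    by rewrite /ip; under [in RHS]eq_Rintegral do rewrite mulr1.
  have Le' := L2S (measurable_oo a b) (measurable_oo a x) sub Le.
  apply: le_trans (cauchy_schwarz (measurable_oo a x) Le' (L2_cst a x 1)) _.
  by rewrite ip_one// ler_pM ?ip_ge0 ?subr_ge0 ?lerD2r//; exact: ip_le_sub.
have -> : e n * (b - a) * (b - a) = \int[mu]_(x in `]a, b[) (e n * (b - a)).
  rewrite Rintegral_cst//; congr (_ * _).
  have := lebesgue_measure_itv `]a, b[; rewrite /= lte_fin => ->.
  by move: ab; rewrite le_eqVlt => /predU1P[->|->//]; rewrite ltxx subrr.
apply: (@le_Rintegral _ _ _ mu _ _ _ (measurable_oo a b)).
- by apply: L2_ip => //; exact: L2B.
- by apply: L2_integrable; exact: L2_cst.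
- by move=> x xab; rewrite -expr2; exact: bnd.
Qed.

Lemma prim_point_value x y : a < x < b -> point_value `]a, b[ u x y -> prim a g x = y.
Proof.
move=> xab [ur [cur uur <-]].
have /andP[ax xb] := xab; have ab : a <= b by rewrite ltW// (lt_trans ax).
apply/eqP; rewrite -subr_eq0; apply/eqP.
apply: (@continuous_ae_eq0 a b (fun x => prim a g x - ur x) x xab).
  apply: cvgB; first exact: prim_continuous.
  move: cur; rewrite continuous_open_subspace; last exact: interval_open.
  by apply; rewrite inE/= in_itv.
by apply: aeS2 (ae_eq_prim ab) uur => z h1 h2 zI; rewrite -h1// -h2// subrr.
Qed.

End PrimitiveOfPair.

Lemma H10pair_eq0 a b u g : a <= b -> H10pair `]a, b[ u g ->
  {ae mu, forall x, `]a, b[%classic x -> g x = 0} ->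
  {ae mu, forall x, `]a, b[%classic x -> u x = 0}.
Proof.
move=> ab ug g0; apply: aeS (ae_eq_prim ug ab) => x ux /[dup] xab /ux ->.
case: ug => _ Lg _; move: xab; rewrite /= in_itv/= => /andP[/ltW ax /ltW xb].
have sub := subset_oo (lexx a) xb.
have L0 : L2 `]a, x[ (fun=> 0 : R) by exact: L2_cst.
rewrite /prim (@ip_ae _ _ _ (fun=> 0) _ (measurable_oo a x))//.
- exact: ip0l.
- exact: L2S Lg.
- exact: L2_cst.
- by apply: aeS g0 => y g0 /sub /g0.
Qed.

End ContinuousRepresentative.

(** * Energy arguments *)
Section Energy.
Context {R : realType}.
Local Notation mu := (@lebesgue_measure R).
Implicit Types (D E : set R) (A f g h p q u v z : R -> R) (a b c d x y beta m : R).
Local Notation one := (fun=> 1 : R).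

(** The bilinear form is the inner product of [u'] with [A v' + beta v], which
    is this function for [h = v']. *)
Definition coflux A beta v h : R -> R := fun x => A x * h x + beta * v x.

(** The weak derivatives chosen in [aform] can be replaced by any others, and
    the advection field by its constant value. *)
Lemma aformE a b A adv beta u g v h : Linfty `]a, b[ A -> Linfty `]a, b[ adv ->
  {ae mu, forall x, `]a, b[%classic x -> adv x = beta} ->
  wpair `]a, b[ u g -> wpair `]a, b[ v h ->
  aform A adv `]a, b[ u v = ip `]a, b[ g (coflux A beta v h).
Proof.
move=> [mA _] [madv _] advE ug vh.
have mg := L2_meas (let: And3 _ L _ := ug in L).
have mh := L2_meas (let: And3 _ L _ := vh in L).
have mv := L2_meas (let: And3 L _ _ := vh in L).
have [_ /L2_meas mwu _] := H1_wpair (wpair_H1 ug).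
have [_ /L2_meas mwv _] := H1_wpair (wpair_H1 vh).
congr fine; apply: ae_eq_integral => //.
- apply/measurable_EFinP/measurable_funD.
    by apply: measurable_funM => //; exact: measurable_funM.
  by apply: measurable_funM => //; exact: measurable_funM.
- apply/measurable_EFinP/measurable_funM => //; apply: measurable_funD.
    exact: measurable_funM.
  by apply: measurable_funM => //; exact: measurable_cst.
- have vE : {ae mu, forall x, `]a, b[%classic x ->
      wderiv `]a, b[ v x = h x /\ adv x = beta}.
    by apply: aeS2 (wpair_wderiv vh) advE => x h1 h2 xI; rewrite h1// h2.
  apply: aeS2 (wpair_wderiv ug) vE => x h1 h2 xI.
  by rewrite h1// (h2 xI).1 (h2 xI).2 /coflux; congr EFin; ring.
Qed.

Lemma LinftyS D E f : measurable D -> E `<=` D -> Linfty D f -> Linfty E f.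
Proof.
move=> mD ED [mf [C fC]]; split; first exact: (measurable_funS mD ED mf).
by exists C; apply: aeS fC => x fC /ED/fC.
Qed.

Lemma coflux_L2 a b A beta v h : Linfty `]a, b[ A ->
  L2 `]a, b[ v -> L2 `]a, b[ h -> L2 `]a, b[ (coflux A beta v h).
Proof. by move=> LA Lv Lh; apply: L2D => //; [exact: L2M|exact: L2Z]. Qed.

(** The integrand is nonnegative almost everywhere with integral zero. *)
Lemma energy_eq0 a b A m g : Linfty `]a, b[ A -> 0 < m ->
  {ae mu, forall x, `]a, b[%classic x -> m <= A x} -> L2 `]a, b[ g ->
  ip `]a, b[ g (fun x => A x * g x) = 0 ->
  {ae mu, forall x, `]a, b[%classic x -> g x = 0}.
Proof.
move=> LA m0 mA Lg E0; have mI := measurable_oo a b.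
have LAg := L2M mI LA Lg.
have mf : measurable_fun `]a, b[ (fun x => (g x * (A x * g x))%:E).
  by apply/measurable_EFinP/measurable_funM; exact: L2_meas.
have i0 : (\int[mu]_(x in `]a, b[) `|(g x * (A x * g x))%:E| = 0)%E.
  transitivity (\int[mu]_(x in `]a, b[) (g x * (A x * g x))%:E)%E.
    apply: ae_eq_integral => //; first exact: measurableT_comp.
    apply: aeS mA => x mA /mA mAx; rewrite gee0_abs// lee_fin mulrCA -expr2.
    by rewrite mulr_ge0 ?sqr_ge0// (le_trans (ltW m0)).
  rewrite -[LHS]fineK; first by congr EFin.
  by apply: integrable_fin_num => //; exact: L2_ip.
have := (ae_eq_integral_abs mu mI mf).1 i0.
apply: aeS2 mA => x mA gx xI; have := gx xI => -[] /eqP.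
rewrite mulrCA mulf_eq0 mulf_eq0 orbb gt_eqF/=; first by move/eqP.
exact: lt_le_trans (mA xI).
Qed.

(** A solution of the homogeneous equation that takes equal values at the two
    endpoints is constant. By the lemma of du Bois-Reymond its flux [A g - beta z] is
    a constant [C]; multiplied by [g] and integrated, this reads
    [int A g^2 - beta int z g = C int g], where [int z g] and [int g] are the
    increments of [z^2 / 2] and of [z]. So [int A g^2 = 0]. *)
Lemma zero_increment_eq0 a b A beta m z g : a < b -> Linfty `]a, b[ A -> 0 < m ->
  {ae mu, forall x, `]a, b[%classic x -> m <= A x} ->
  wpair `]a, b[ z g -> ip `]a, b[ g one = 0 -> ip `]a, b[ z g = 0 ->
  (forall v, Cc1 `]a, b[ v ->
     ip `]a, b[ g (coflux A beta v (derive1 v)) = 0) ->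
  {ae mu, forall x, `]a, b[%classic x -> g x = 0}.
Proof.
move=> ab LA m0 mA [Lz Lg zg] g1 zg0 weak; have mI := measurable_oo a b.
have LAg := L2M mI LA Lg; have Lbz := L2Z beta mI Lz.
have Lq := L2B mI LAg Lbz.
have [v Cv|C qC] := du_bois_reymond ab Lq.
  have Lv := @Cc1_L2 _ a b _ _ Cv; have Lv' := @Cc1_derive1_L2 _ a b _ _ Cv.
  rewrite ipBl// ipZl//; have := zg _ Cv; rewrite -/(ip _ _ _) -/(ip _ _ _) => ->.
  have := weak _ Cv; rewrite /coflux ipDr ?ipZr//; [|exact: L2M|exact: L2Z].
  rewrite mulrN opprK => E; rewrite -[RHS]E; congr (_ + _).
  by apply: eq_Rintegral => x _; rewrite mulrCA mulrA.
have LC : L2 `]a, b[ (fun=> C) by exact: L2_cst.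
have := ip_ae mI Lq LC Lg qC; rewrite ipBl// ipZl// zg0 mulr0 subr0.
rewrite (_ : (fun=> C) = fun x => C * one x); last by apply/funext => x; rewrite mulr1.
rewrite ipZl//; last exact: L2_cst.
by rewrite ipC [ip _ one g]ipC g1 mulr0; exact: energy_eq0 mA Lg.
Qed.

End Energy.

(** * Meshes *)
Section Mesh.
Context {R : realType}.
Variables (l r : R) (N : nat) (x : nat -> R).
Hypothesis x_mesh : is_mesh l r N x.

Lemma mesh_lt i j : (i < j)%N -> (j <= N.+1)%N -> x i < x j.
Proof.
case: x_mesh => _ _ xS; elim: j => // j IH; rewrite ltnS leq_eqVlt => /predU1P[->|ij] jN.
  exact: xS.
by apply: lt_trans (xS _ jN); apply: IH => //; exact: ltnW.
Qed.

Lemma mesh_le i j : (i <= j)%N -> (j <= N.+1)%N -> x i <= x j.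
Proof. by rewrite leq_eqVlt => /predU1P[->//|ij jN]; apply/ltW/mesh_lt. Qed.

(** Compare [y] with the first node that is not to its left. *)
Lemma mesh_cover y : l < y < r ->
  (exists2 k, (k <= N)%N & elt x k y) \/ exists k, y = x k.
Proof.
case: x_mesh => x0 xN _ /andP[ly yr].
have ex : exists j, y <= x j by exists N.+1; rewrite xN ltW.
case: (ex_minnP ex) => -[|j] yj jmin; first by move: ly; rewrite -x0 ltNge yj.
have jN : (j <= N)%N by rewrite -ltnS; apply: jmin; rewrite xN ltW.
move: yj; rewrite le_eqVlt => /predU1P[yE|yj]; [by right; exists j.+1|left].
exists j => //; rewrite /elt/= in_itv/= yj andbT ltNge.
by apply/negP => /jmin; rewrite ltnn.
Qed.

Lemma mesh_ae (P : R -> Prop) :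
  (forall k, (k <= N)%N -> {ae @lebesgue_measure R, forall y, elt x k y -> P y}) ->
  {ae @lebesgue_measure R, forall y, `]l, r[%classic y -> P y}.
Proof.
move=> HP.
have H1 : {ae @lebesgue_measure R, forall y, forall k, (k <= N)%N -> elt x k y -> P y}.
  apply: ae_foralln => k; have [kN|kN] := leqP k N.
    by apply: aeS (HP k kN) => y yP _.
    exact: aeW.
have H2 : {ae @lebesgue_measure R, forall y, forall k, y <> x k}.
  apply: ae_foralln => k; exists [set x k]; split => //.
    exact: lebesgue_measure_set1.
  by move=> y /= /contrapT.
apply: aeS2 H1 H2 => y h1 h2; rewrite /= in_itv/= => /mesh_cover[[k kN yk]|[k /h2]//].
exact: h1 yk.
Qed.

End Mesh.

(** * Exactness of the method *)
Section Exactness.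
Context {R : realType}.
Local Notation mu := (@lebesgue_measure R).
Local Notation one := (fun=> 1 : R).
Implicit Types (h v w g : R -> R).

Definition span_comb (N : nat) (phi : 'I_N -> R -> R) (B : 'I_N.+1 -> R -> R)
    (c : 'I_N -> R) (d : 'I_N.+1 -> R) (y : R) : R :=
  \sum_(i < N) c i * phi i y + \sum_(k < N.+1) d k * B k y.

Lemma span_combB (N : nat) phi (B : 'I_N.+1 -> R -> R) c d c' d' y :
  span_comb phi B (fun i => c i - c' i) (fun k => d k - d' k) y =
  span_comb phi B c d y - span_comb phi B c' d' y.
Proof.
rewrite /span_comb opprD addrACA -!sumrB.
by congr (_ + _); apply: eq_bigr => i _; rewrite mulrBl.
Qed.

Variables (l r : R) (N : nat) (x : nat -> R) (m beta : R) (A b f : R -> R).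
Variables (phi : 'I_N -> R -> R) (B : 'I_N.+1 -> R -> R) (u uHB : R -> R).
Local Notation Omega := `]l, r[%classic.
Hypothesis lr : l < r.
Hypothesis x_mesh : is_mesh l r N x.
Hypothesis m_gt0 : 0 < m.
Hypothesis A_Linfty : Linfty Omega A.
Hypothesis A_ge : {ae mu, forall y, Omega y -> m <= A y}.
Hypothesis b_Linfty : Linfty Omega b.
Hypothesis bE : {ae mu, forall y, Omega y -> b y = beta}.
Variable fc : 'I_N.+1 -> R.
Hypothesis fcE : forall (k : 'I_N.+1) y, elt x k y -> f y = fc k.
Hypothesis phi_basis : is_basis A b Omega x phi.
Hypothesis B_bubbles : is_bubbles A b x B.
Hypothesis u_H10 : H10 Omega u.
Hypothesis u_sol : weak_sol A b Omega f u.
Hypothesis uHB_V : VHB phi B uHB.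
Hypothesis uHB_sol : forall v, VHB phi B v ->
  aform A b Omega uHB v = \int[mu]_(y in Omega) (f y * v y).

Let lrW : l <= r := ltW lr.
Let x0 : x 0%N = l. Proof. by case: x_mesh. Qed.
Let xN : x N.+1 = r. Proof. by case: x_mesh. Qed.

Let le_node (j : nat) : (j <= N.+1)%N -> l <= x j.
Proof. by move=> jN; rewrite -x0 (mesh_le x_mesh). Qed.

Let node_le (j : nat) : (j <= N.+1)%N -> x j <= r.
Proof. by move=> jN; rewrite -xN (mesh_le x_mesh). Qed.

Let elt_lt (k : 'I_N.+1) : x k < x k.+1.
Proof. exact: (mesh_lt x_mesh). Qed.

Let le_elt (k : 'I_N.+1) : l <= x k.
Proof. exact/le_node/ltnW. Qed.

Let elt_le (k : 'I_N.+1) : x k.+1 <= r.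
Proof. exact: node_le. Qed.

Let sub_elt (k : 'I_N.+1) : elt x k `<=` Omega.
Proof. exact: (subset_oo (le_elt k) (elt_le k)). Qed.

Let Linfty_elt (k : 'I_N.+1) h : Linfty Omega h -> Linfty (elt x k) h.
Proof. exact: LinftyS. Qed.

Let ae_elt (k : 'I_N.+1) (P : R -> Prop) :
  {ae mu, forall y, Omega y -> P y} -> {ae mu, forall y, elt x k y -> P y}.
Proof. by apply: aeS => y Py /sub_elt/Py. Qed.

Let gu := wderiv Omega u.
Let c (i : 'I_N) := prim l gu (x i.+1).
Let gphi i := wderiv Omega (phi i).
Let gB (k : 'I_N.+1) := wderiv (elt x k) (B k) \_ (elt x k).

Let u_pair : H10pair Omega u gu. Proof. exact: H10_H10pair. Qed.

Let phi_pair i : H10pair Omega (phi i) (gphi i).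
Proof. by apply: H10_H10pair; case: (phi_basis i). Qed.

Let B_pair_elt (k : 'I_N.+1) : H10pair (elt x k) (B k) (wderiv (elt x k) (B k)).
Proof. by apply: H10_H10pair; case: (B_bubbles k). Qed.

Let B_pair (k : 'I_N.+1) : H10pair Omega (B k) (gB k).
Proof.
have [_ _ B0] := B_bubbles k.
exact: (H10pair_extend (le_elt k) (elt_le k) B0 (B_pair_elt k)).
Qed.

Lemma span_comb_pair s t :
  H10pair Omega (span_comb phi B s t) (span_comb gphi gB s t).
Proof.
have E (h g : R -> R) : (fun y => 1 * h y + g y) = fun y => h y + g y.
  by apply/funext => y; rewrite mul1r.
have := H10pair_comb 1 (H10pair_sum s phi_pair) (H10pair_sum t B_pair).
by rewrite !E.
Qed.

(** The discrete function subtracted from [u] has the nodal values of [u], and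
    its bubbles produce the right-hand side [f] in each element. *)
Definition residual y :=
  u y - span_comb phi B c fc y.
Definition dresidual y :=
  gu y - span_comb gphi gB c fc y.

Lemma residual_pair : H10pair Omega residual dresidual.
Proof.
have := H10pair_comb (-1) (span_comb_pair c fc) u_pair.
by congr H10pair; apply/funext => y; rewrite mulN1r addrC.
Qed.

Lemma ip_dresidual a' b' h : l <= a' -> b' <= r -> L2 `]a', b'[ h ->
  ip `]a', b'[ dresidual h = ip `]a', b'[ gu h -
    (\sum_(i < N) c i * ip `]a', b'[ (gphi i) h +
     \sum_(k < N.+1) fc k * ip `]a', b'[ (gB k) h).
Proof.
move=> la br Lh; have L2sub g : L2 Omega g -> L2 `]a', b'[ g.
  exact: (L2S _ _ (subset_oo la br)).
have Lgu : L2 `]a', b'[ gu by apply: L2sub; case: u_pair.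
have Lgphi i : L2 `]a', b'[ (gphi i) by apply: L2sub; case: (phi_pair i).
have LgB k : L2 `]a', b'[ (gB k) by apply: L2sub; case: (B_pair k).
have mI := measurable_oo a' b'.
have L1 := L2_sum c mI Lgphi.
have L2' := L2_sum fc mI LgB.
rewrite ipBl//; last exact: L2D.
by rewrite ipDl// !ip_suml.
Qed.

(** A bubble is a function of [H^1_0] of its element, so its derivative has
    integral zero there: it vanishes at all the nodes. *)
Lemma bubble_node (k : 'I_N.+1) (j : nat) : (j <= N.+1)%N ->
  prim l (gB k) (x j) = 0.
Proof.
move=> jN; have [jk|kj] := leqP j k.
  rewrite -[RHS](ip0l `]l, x j[ one).
  apply: eq_Rintegral => y; rewrite inE/= in_itv/= => /andP[_ yj]; congr (_ * _).
  rewrite /gB patchE memNset// /elt/= in_itv/= ltNge.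
  by rewrite (le_trans (ltW yj)) ?(mesh_le x_mesh)// ltnW.
rewrite /prim (@ip_sub _ _ (elt x k)).
- rewrite -[RHS](H10pair_int0 (ltW (elt_lt k)) (B_pair_elt k)).
  by apply: eq_Rintegral => y yk; rewrite /gB patchE yk.
- by move=> y _ yk; left; rewrite /gB patchE memNset.
- by apply: subset_itv; rewrite bnd_simp// (mesh_le x_mesh).
Qed.

(** The nodal values prescribed through some continuous representative are those
    of [prim]. *)
Lemma basis_node i j (jN : (j < N)%N) :
  prim l (gphi i) (x j.+1) = (i == Ordinal jN)%:R.
Proof.
have [_ /(_ (Ordinal jN)) pv _] := phi_basis i.
apply: (prim_point_value (phi_pair i) _ pv).
by rewrite -x0 -xN !(mesh_lt x_mesh)// ltnW.
Qed.

Lemma residual_node (j : nat) : (j <= N.+1)%N -> prim l dresidual (x j) = 0.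
Proof.
move=> jN; have -> : prim l dresidual (x j) = prim l gu (x j) -
    (\sum_(i < N) c i * prim l (gphi i) (x j) +
     \sum_(k < N.+1) fc k * prim l (gB k) (x j)).
  exact: (ip_dresidual (lexx l) (node_le jN) (L2_cst _ _ _)).
rewrite [X in _ - (_ + X)]big1 ?addr0 => [|k _]; last first.
  by rewrite bubble_node// mulr0.
case: j jN => [|j] jN.
  by rewrite x0 prim_left big1 ?subrr// => i _; rewrite prim_left mulr0.
have [jN'|Nj] := ltnP j N; last first.
  have -> : j = N by apply/eqP; rewrite eqn_leq -ltnS jN.
  rewrite xN (prim_right u_pair)// big1 ?subrr// => i _.
  by rewrite (prim_right (phi_pair i))// mulr0.
rewrite (bigD1 (Ordinal jN'))//= big1 ?addr0 => [|i ij].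
  by rewrite basis_node eqxx mulr1 subrr.
by rewrite basis_node (negbTE ij) mulr0.
Qed.

Lemma aform_elt (k : 'I_N.+1) w g v : wpair (elt x k) w g -> Cc1 (elt x k) v ->
  aform A b (elt x k) w v = ip (elt x k) g (coflux A beta v (derive1 v)).
Proof.
move=> wg /Cc1_C1 Cv; apply: aformE => //.
- exact: Linfty_elt.
- exact: Linfty_elt.
- exact: ae_elt.
- exact: C1_wpair.
Qed.

Lemma Cc1_H10_elt (k : 'I_N.+1) v : Cc1 (elt x k) v -> H10 (elt x k) v.
Proof. by move=> Cv; exact: H10pair_H10 (ltW (elt_lt k)) (Cc1_H10pair Cv). Qed.

Lemma solution_elt (k : 'I_N.+1) v : Cc1 (elt x k) v ->
  ip (elt x k) gu (coflux A beta v (derive1 v)) = fc k * ip (elt x k) one v.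
Proof.
move=> Cv; have CvO : Cc1 Omega v := Cc1S (@sub_elt k) Cv.
have := u_sol (H10pair_H10 lrW (Cc1_H10pair CvO)).
rewrite (aformE A_Linfty b_Linfty bE (H10pair_wpair lrW u_pair)
  (C1_wpair l r (Cc1_C1 CvO))) -/(ip _ f v).
rewrite !(@ip_sub _ Omega (elt x k)) => [->|y _ yk||y _ yk|];
  do ?[exact: sub_elt].
- rewrite -ipZl//; [|exact: measurable_oo|exact: L2_cst|exact: Cc1_L2 Cv].
  by apply/eq_Rintegral => y /set_mem yk; rewrite mulr1 (fcE yk).
- by right; exact: (Cc1_out Cv yk).
- by right; rewrite /coflux (Cc1_out Cv yk) (Cc1_derive1_out Cv yk) !mulr0 addr0.
Qed.

Lemma basis_elt i (k : 'I_N.+1) v : Cc1 (elt x k) v ->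
  ip (elt x k) (gphi i) (coflux A beta v (derive1 v)) = 0.
Proof.
move=> Cv; have [_ _ /(_ k v (Cc1_H10_elt Cv))] := phi_basis i.
rewrite (aform_elt _ Cv (g := gphi i)) => [->|].
  by rewrite -/(ip _ _ v) ip0l.
exact: wpairS (le_elt k) (elt_le k) (H10pair_wpair lrW (phi_pair i)).
Qed.

Lemma bubble_elt (k : 'I_N.+1) v : Cc1 (elt x k) v ->
  ip (elt x k) (gB k) (coflux A beta v (derive1 v)) = ip (elt x k) one v.
Proof.
move=> Cv; have [_ /(_ v (Cc1_H10_elt Cv)) + _] := B_bubbles k.
rewrite (aform_elt (H10pair_wpair (ltW (elt_lt k)) (B_pair_elt k)) Cv) => Bv.
by rewrite -[RHS]Bv; apply: eq_Rintegral => y yk; rewrite /gB patchE yk.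
Qed.

Lemma elt_disjoint (k k' : 'I_N.+1) y : elt x k y -> elt x k' y -> k = k'.
Proof.
rewrite /elt/= !in_itv/= => /andP[ky yk] /andP[k'y yk'].
apply/val_inj => /=; case: (ltngtP k k') => // [kk|kk].
  have := mesh_le x_mesh kk (ltnW (ltn_ord k')).
  by rewrite leNgt (lt_trans k'y yk).
have := mesh_le x_mesh kk (ltnW (ltn_ord k)).
by rewrite leNgt (lt_trans ky yk').
Qed.

Lemma bubble_other_elt (k k' : 'I_N.+1) h : k' != k -> ip (elt x k) (gB k') h = 0.
Proof.
move=> kk; rewrite -[RHS](ip0l (elt x k) h).
apply: eq_Rintegral => y /set_mem yk; rewrite /gB patchE memNset// => yk'.
by move/eqP: kk; apply; exact: elt_disjoint yk' yk.
Qed.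

(** The equations of [u] and of the bubble of the element both have a right-hand
    side constant on the element, and these cancel; the basis functions solve
    the homogeneous equation, and the other bubbles vanish there. *)
Lemma residual_elt (k : 'I_N.+1) v : Cc1 (elt x k) v ->
  ip (elt x k) dresidual (coflux A beta v (derive1 v)) = 0.
Proof.
move=> Cv; rewrite ip_dresidual//; last first.
  apply: coflux_L2; [exact: Linfty_elt|exact: Cc1_L2 Cv|exact: Cc1_derive1_L2 Cv].
rewrite big1 ?add0r => [|i _]; last by rewrite basis_elt// mulr0.
rewrite (bigD1 k)//= bubble_elt// big1 ?addr0 => [|k' k'k].
  by rewrite solution_elt// subrr.
by rewrite bubble_other_elt// mulr0.
Qed.

(** The residual is zero at the nodes and solves the homogeneous equation in
    each element. *)
Lemma dresidual_eq0 : {ae mu, forall y, Omega y -> dresidual y = 0}.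
Proof.
apply: (mesh_ae x_mesh) => k0 k0N; pose k := Ordinal (k0N : (k0 < N.+1)%N).
have lt_k : x k < x k.+1 := elt_lt k.
have zero j : (j <= N.+1)%N -> prim l dresidual (x j) = 0 := @residual_node j.
apply: (@zero_increment_eq0 _ _ _ A beta m residual dresidual lt_k) => //.
- exact: (@Linfty_elt k).
- exact: (@ae_elt k).
- exact: wpairS (le_elt k) (elt_le k) (H10pair_wpair lrW residual_pair).
- rewrite (prim_increment residual_pair (le_elt k) (ltW lt_k) (elt_le k)).
  by rewrite !zero ?subrr// ltnW.
- rewrite (prim_energy residual_pair (le_elt k) (ltW lt_k) (elt_le k)).
  by rewrite !zero ?expr0n ?subrr ?mul0r// ltnW.
- exact: (@residual_elt k).
Qed.

(** By the previous lemma [u] is in the discrete space, up to equality almost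
    everywhere. The error [w] is then an admissible test function, and
    [a(w, w) = 0]. The advective part [beta int w w'] of this form is zero
    because [w] vanishes at both ends. *)
Lemma msfem_exact : {ae mu, forall y, Omega y -> uHB y = u y}.
Proof.
have res0 := H10pair_eq0 lrW residual_pair dresidual_eq0.
have [c' [d' /funext uHBE]] := uHB_V.
pose w := span_comb phi B (fun i => c i - c' i) (fun k => fc k - d' k).
pose gw := span_comb gphi gB (fun i => c i - c' i) (fun k => fc k - d' k).
have w_pair : H10pair Omega w gw by exact: span_comb_pair.
have uHB_pair : H10pair Omega uHB (span_comb gphi gB c' d').
  by rewrite uHBE; exact: span_comb_pair.
have gwE : {ae mu, forall y, Omega y -> gu y - span_comb gphi gB c' d' y = gw y}.
  apply: aeS dresidual_eq0 => y gz0 /gz0 /eqP; rewrite subr_eq0 => /eqP ->.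
  by rewrite /gw span_combB.
have [Lw Lgw _] := w_pair; have [_ Lgu _] := u_pair; have [_ LgHB _] := uHB_pair.
have LW := coflux_L2 beta A_Linfty Lw Lgw.
have wW := H10pair_wpair lrW w_pair; have mO := measurable_oo l r.
have galerkin : ip Omega gw (coflux A beta w gw) = 0.
  have wV : VHB phi B w by exists (fun i => c i - c' i), (fun k => fc k - d' k).
  have := u_sol (H10pair_H10 lrW w_pair); rewrite -(uHB_sol wV).
  rewrite (aformE A_Linfty b_Linfty bE (H10pair_wpair lrW uHB_pair) wW).
  rewrite (aformE A_Linfty b_Linfty bE (H10pair_wpair lrW u_pair) wW) => E.
  by rewrite -(ip_ae mO _ _ _ gwE)//; [rewrite ipBl// E subrr|exact: L2B].
have energy0 : ip Omega gw (fun y => A y * gw y) = 0.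
  move: galerkin; rewrite ipDr//; [|exact: L2M|exact: L2Z].
  rewrite ipZr// [ip _ gw w]ipC (prim_energy w_pair (lexx l) lrW (lexx r)).
  by rewrite (prim_right w_pair lrW) prim_left subrr mul0r mulr0 addr0.
have w0 := H10pair_eq0 lrW w_pair (energy_eq0 A_Linfty m_gt0 A_ge Lgw energy0).
apply: aeS2 res0 w0 => y uy wy yI.
have := uy yI; have := wy yI; rewrite /residual /w span_combB uHBE => /eqP.
by rewrite subr_eq0 => /eqP -> /eqP; rewrite subr_eq0 => /eqP.
Qed.

End Exactness.

Theorem lemma3p1 (R : realType) (l r : R) (N : nat) (x : nat -> R)
    (m M : R) (A b f : R -> R)
    (phi : 'I_N -> R -> R) (B : 'I_N.+1 -> R -> R) (u uHB : R -> R)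
    (lr : l < r)
    (x_mesh : is_mesh l r N x)
    (m_gt0 : 0 < m) (mM : m <= M)
    (A_Linfty : Linfty `]l, r[%classic A)
    (A_bounds : {ae @lebesgue_measure R, forall y, `]l, r[%classic y -> m <= A y <= M})
    (b_Linfty : Linfty `]l, r[%classic b)
    (b_div : divergence_free `]l, r[%classic b)
    (f_const : piecewise_constant N x f)
    (phi_basis : is_basis A b `]l, r[%classic x phi)
    (B_bubbles : is_bubbles A b x B)
    (u_H10 : H10 `]l, r[%classic u)
    (u_sol : weak_sol A b `]l, r[%classic f u)
    (uHB_V : VHB phi B uHB)
    (uHB_sol : forall v, VHB phi B v ->
       aform A b `]l, r[%classic uHB v = \int[@lebesgue_measure R]_(y in `]l, r[%classic) (f y * v y)) :
  {ae @lebesgue_measure R, forall y, `]l, r[%classic y -> uHB y = u y}.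
Proof.
have b_L2 : L2 `]l, r[ b.
  have := L2M (measurable_oo l r) b_Linfty (L2_cst l r 1).
  by congr L2; apply/funext => y; rewrite mulr1.
have [beta bE] := wderiv0_const lr b_L2 b_div.
have A_ge : {ae @lebesgue_measure R, forall y, `]l, r[%classic y -> m <= A y}.
  by apply: aeS A_bounds => y Ay /Ay/andP[].
have [fc fcE] := choice f_const.
exact: (msfem_exact lr x_mesh m_gt0 A_Linfty A_ge b_Linfty bE fcE).
Qed.
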